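(* Let $\Sigma\subset\mathbb{R}^{n+1}$ be a pure, hereditary, $(n+1)$-dimensional fan with smoothness parameters $\alpha$, and set $S=\mathbb{R}[x_0,\ldots,x_n]$. For every $i$ with $1\le i\le n$: (1) $\mathrm{Ass}_S\big(H_i(\mathcal{R}/\mathcal{J}[\Sigma,\Sigma^{-1}])\big)\subseteq\{I(W)\mid W\in L_{\Sigma,\Sigma^{-1}},\ \dim W\le i-1\}$. (2) If $H_i(\mathcal{R}[\Sigma_{W,\sigma},\Sigma^{-1}_{W,\sigma}])=0$ for every $W\in L_{\Sigma,\Sigma^{-1}}$ with $\dim W=i-1$ and every facet $\sigma\in\Sigma_{n+1}$, then $\mathrm{Ass}_S\big(H_i(\mathcal{R}/\mathcal{J}[\Sigma,\Sigma^{-1}])\big)\subseteq\{I(W)\mid W\in L_{\Sigma,\Sigma^{-1}},\ \dim W\le i-2\}$. (3) If $\Sigma$ is simplicial, then $\mathrm{Ass}_S\big(H_i(\mathcal{R}/\mathcal{J}[\Sigma,\Sigma^{-1}])\big)\subseteq\{I(\gamma)\mid \gamma\in\Sigma,\ \mathrm{aff}(\gamma)\in L_{\Sigma,\Sigma^{-1}},\ \dim\gamma\le i-2\}$.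
   Context: A cone in $\mathbb{R}^{n+1}$ is the positive hull of a finite set of vectors; its dimension is that of its linear span $\mathrm{aff}(\gamma)$; its faces are itself and its intersections with supporting hyperplanes through the origin. A fan $\Sigma$ is a finite set of cones closed under taking faces such that any two meet in a common face; $\Sigma_i$ denotes its $i$-dimensional cones (so $\Sigma_0=\{\{0\}\}$), facets are maximal cones. $\Sigma$ is pure $(n+1)$-dimensional if all facets have dimension $n+1$. For a face $\psi$, $\mathrm{st}_\Sigma(\psi)$ is the subfan of all faces of facets containing $\psi$; its dual graph has a vertex per facet and an edge when two facets meet in an $n$-dimensional face. $\Sigma$ is hereditary if the dual graph of $\mathrm{st}_\Sigma(\psi)$ is connected for every face $\psi$. The boundary $\partial\Sigma$ is the subfan of faces contained in an $n$-face lying in exactly one facet; other faces are interior. $\Sigma$ is simplicial if every cone is generated by linearly independent vectors. For a cone $\gamma$, $I(\gamma)\subset S$ is the ideal of $\mathrm{aff}(\gamma)$, and for a linear subspace $W$, $I(W)$ its ideal; for $\tau\in\Sigma_n$, $l_\tau$ is a linear form generating $I(\tau)$. Smoothness parameters: integers $\alpha(\tau)\ge -1$ for $\tau\in\Sigma_n$, with $\alpha(\tau)\ge0$ for interior $\tau$. $\Sigma^{-1}$ is the subfan of $\partial\Sigma$ of cones contained in some $\tau\in\Sigma_n$ with $\alpha(\tau)=-1$, and $\Sigma^{\ge0}_i=\Sigma_i\setminus\Sigma^{-1}_i$. Complexes: let $u_\rho$ be the unit generator of a ray $\rho$; for a cone $\gamma$ let $P(\gamma)=\mathrm{conv}(\{0\}\cup\{u_\rho:\rho\subseteq\gamma\text{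 a ray}\})$ and $\mathrm{lk}(\gamma)=\mathrm{conv}\{u_\rho:\rho\subseteq\gamma\}$, giving polytopal complexes $P(\Gamma),\mathrm{lk}(\Gamma)$ for any fan $\Gamma$. For a fan $\Gamma$ and subfan $\Gamma'$, $\mathcal{R}[\Gamma,\Gamma']$ is the complex with $\mathcal{R}[\Gamma,\Gamma']_i=\bigoplus_{\gamma\in\Gamma_i\setminus\Gamma'_i}S$ ($0\le i\le n+1$) whose differential is the cellular boundary map of the relative cellular chain complex of the pair $(P(\Gamma),\mathrm{lk}(\Gamma)\cup P(\Gamma'))$ with coefficients in $S$ (the summand of $\gamma$ corresponding to the cell $P(\gamma)$). Given a subfan $\Gamma^{-}\subseteq\Gamma$ playing the role of $\Sigma^{-1}$, set $J(\tau)=\langle l_\tau^{\alpha(\tau)+1}\rangle$ for $\tau\in\Gamma_n\setminus\Gamma^-_n$, $J(\gamma)=\sum_{\tau\in\Gamma_n\setminus\Gamma^-_n,\ \gamma\subseteq\tau}J(\tau)$ for non-facets $\gamma$, $J(\sigma)=0$ for facets. $\mathcal{J}[\Gamma,\Gamma']_i=\bigoplus_{\gamma\in\Gamma_i\setminus\Gamma'_i}J(\gamma)$ is a subcomplex of $\mathcal{R}[\Gamma,\Gamma']$ and $\mathcal{R}/\mathcal{J}[\Gamma,\Gamma']$ is the quotient complex, $\mathcal{R}/\mathcal{J}[\Gamma,\Gamma']_i=\bigoplus_{\gamma\in\Gamma_i\setminus\Gamma'_i}S/J(\gamma)$. For $\mathcal{R}/\mathcal{J}[\Sigma,\Sigma^{-1}]$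 take $\Gamma^-=\Sigma^{-1}$; for $\mathcal{R}/\mathcal{J}[\Sigma_{W,\sigma},\Sigma^{-1}_{W,\sigma}]$ take $\Gamma=\Sigma_{W,\sigma}$, $\Gamma^-=\Sigma^{-1}_{W,\sigma}$. Lattice: $L_{\Sigma,\Sigma^{-1}}$ is the set of all intersections of subsets of the hyperplanes $\{\mathrm{aff}(\tau):\tau\in\Sigma_n\setminus\Sigma^{-1}_n\}$ (including $\mathbb{R}^{n+1}$). For $W\in L_{\Sigma,\Sigma^{-1}}$ and a facet $\sigma$, $\Sigma_{W,\sigma}$ is the subfan of all faces of facets $\sigma'$ for which there is a chain of facets $\sigma=\sigma_0,\ldots,\sigma_k=\sigma'$ with $\sigma_{j-1}\cap\sigma_j=\tau_j\in\Sigma_n$ and $W\subseteq\mathrm{aff}(\tau_j)$ for all $j$. $\Sigma^c_W$ is the subfan of faces $\gamma$ with $W\not\subseteq\mathrm{aff}(\gamma)$, and $\Sigma^{-1}_{W,\sigma}=(\Sigma^c_W\cup\Sigma^{-1})\cap\Sigma_{W,\sigma}$. *)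

(* Defs.v *)
From HB Require Import structures.
From mathcomp Require Import all_boot all_order all_algebra.
From mathcomp Require Import reals.
From mathcomp Require Import mpoly.
From Stdlib Require Import ClassicalEpsilon.

Set Implicit Arguments.
Unset Strict Implicit.
Unset Printing Implicit Defensive.

Import Order.TTheory GRing.Theory Num.Theory.
Local Open Scope ring_scope.

Section FanDefs.
Variables (R : realType) (n : nat).

Local Notation vec := 'rV[R]_(n.+1).
Local Notation S := {mpoly R[n.+1]}.

Definition pdec (P : Prop) : bool :=
  if excluded_middle_informative P then true else false.

Definition dotv (u x : vec) : R := \sum_(j < n.+1) u 0 j * x 0 j.

Definition lincomb (B : seq vec) (c : nat -> R) : vec :=
  \sum_(j < size B) c j *: B`_j.
Definition in_span (B : seq vec) (x : vec) : Prop :=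
  exists c : nat -> R, x = lincomb B c.
Definition lin_indep (B : seq vec) : Prop :=
  forall c : nat -> R, lincomb B c = 0 -> forall j, (j < size B)%N -> c j = 0.
Definition is_basis (W : vec -> Prop) (B : seq vec) : Prop :=
  lin_indep B /\ forall x, W x <-> in_span B x.
Definition dimW (W : vec -> Prop) (d : nat) : Prop :=
  exists B : seq vec, size B = d /\ is_basis W B.

Definition pos_hull (s : seq vec) (x : vec) : Prop :=
  exists c : nat -> R, (forall j, 0 <= c j) /\ x = lincomb s c.

(* faces of a cone C: C itself and its intersections with supporting
   hyperplanes through the origin (u = 0 gives C itself) *)
Definition face_of (C Fc : vec -> Prop) : Prop :=
  exists u : vec, (forall x, C x -> 0 <= dotv u x) /\
    (forall x, Fc x <-> (C x /\ dotv u x = 0)).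

Definition set_eq (A B : vec -> Prop) := forall x, A x <-> B x.
Definition set_sub (A B : vec -> Prop) := forall x, A x -> B x.

(* A fan is given by a finite list F of generating sets; the cones are
   indexed by 'I_(size F). *)
Variable F : seq (seq vec).
Local Notation idx := 'I_(size F).

Definition gens (k : idx) : seq vec := nth [::] F k.
Definition cone (k : idx) : vec -> Prop := pos_hull (gens k).
Definition aff (k : idx) : vec -> Prop := in_span (gens k).
Definition cdim (k : idx) : nat := \rank (\matrix_(j < size (gens k)) (gens k)`_j).

Definition is_fan : Prop :=
  (forall k Fc, face_of (cone k) Fc -> exists l, set_eq (cone l) Fc) /\
  (forall k l, face_of (cone k) (fun x => cone k x /\ cone l x) /\
               face_of (cone l) (fun x => cone k x /\ cone l x)) /\
  (* it is a set of cones: no cone listed twice *)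
  (forall k l, set_eq (cone k) (cone l) -> k = l).

Definition facet (k : idx) : Prop :=
  forall l, set_sub (cone k) (cone l) -> set_sub (cone l) (cone k).

Definition pure : Prop := forall k, facet k -> cdim k = n.+1.

Definition adjacent (s s' : idx) : Prop :=
  exists t, cdim t = n /\ set_eq (cone t) (fun x => cone s x /\ cone s' x).

Definition chain (Q : idx -> Prop) (E : idx -> idx -> Prop) (s s' : idx) :=
  exists (m : nat) (f : nat -> idx), f 0%N = s /\ f m = s' /\
    (forall j, (j <= m)%N -> Q (f j)) /\
    (forall j, (j < m)%N -> E (f j) (f j.+1)).

(* dual graph of st(psi) connected for every face psi *)
Definition hereditary : Prop :=
  forall psi s s',
    facet s -> set_sub (cone psi) (cone s) ->
    facet s' -> set_sub (cone psi) (cone s') ->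
    chain (fun t => facet t /\ set_sub (cone psi) (cone t)) adjacent s s'.

Definition boundary_nface (t : idx) : Prop :=
  cdim t = n /\ exists s, facet s /\ set_sub (cone t) (cone s) /\
     forall s', facet s' -> set_sub (cone t) (cone s') -> s' = s.

Definition interior_nface (t : idx) : Prop := cdim t = n /\ ~ boundary_nface t.

Definition smoothness (alpha : idx -> int) : Prop :=
  forall t, cdim t = n -> (-1 <= alpha t) /\ (interior_nface t -> 0 <= alpha t).

Definition Sm1 (alpha : idx -> int) (k : idx) : Prop :=
  exists t, cdim t = n /\ alpha t = -1 /\ set_sub (cone k) (cone t).

Definition simplicial : Prop :=
  forall k, exists g, lin_indep g /\ set_eq (cone k) (pos_hull g).

Definition inL (alpha : idx -> int) (W : vec -> Prop) : Prop :=
  exists T : idx -> Prop, (forall t, T t -> cdim t = n /\ ~ Sm1 alpha t) /\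
    set_eq W (fun x => forall t, T t -> aff t x).

Definition SigmaW (W : vec -> Prop) (s : idx) (k : idx) : Prop :=
  exists s', chain facet
     (fun a b => exists t, cdim t = n /\
         set_eq (cone t) (fun x => cone a x /\ cone b x) /\ set_sub W (aff t))
     s s' /\ set_sub (cone k) (cone s').

Definition SigmacW (W : vec -> Prop) (k : idx) : Prop := ~ set_sub W (aff k).

Definition Sm1W (alpha : idx -> int) (W : vec -> Prop) (s : idx) (k : idx) : Prop :=
  (SigmacW W k \/ Sm1 alpha k) /\ SigmaW W s k.

Definition idealW (W : vec -> Prop) (f : S) : Prop :=
  forall x, W x -> f.@[fun j => x 0 j] = 0.

Definition linform (u : vec) : S := \sum_(j < n.+1) u 0 j *: 'X_j.

(* J(tau) = < l_tau^(alpha(tau)+1) >, l_tau a linear form generating I(tau) *)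
Definition Jtau (alpha : idx -> int) (t : idx) (f : S) : Prop :=
  exists (u : vec) (g : S), u != 0 /\ (forall x, aff t x -> dotv u x = 0) /\
     f = g * linform u ^+ absz (alpha t + 1).

(* J(gamma) relative to a subfan G and Gm (the role of Sigma^{-1}) *)
Definition Jid (alpha : idx -> int) (G Gm : idx -> Prop) (k : idx) (f : S) : Prop :=
  exists h : idx -> S,
    (forall t, h t = 0 \/ (G t /\ ~ Gm t /\ cdim t = n /\
                          set_sub (cone k) (cone t) /\ Jtau alpha t (h t))) /\
    f = \sum_t h t.

Definition orientation (o : idx -> seq vec) : Prop := forall k, is_basis (aff k) (o k).

Definition same_orient (A B : seq vec) : Prop :=
  exists (m : nat) (T : 'M[R]_m), size A = m /\ size B = m /\ 0 < \det T /\
    forall j : 'I_m, A`_j = \sum_(l < m) T j l *: B`_l.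

Definition codim1 (l k : idx) : Prop := set_sub (cone k) (cone l) /\ cdim k = (cdim l).-1 /\ (0 < cdim l)%N.

(* incidence numbers of the cellular boundary map of the cells P(l), P(k) *)
Definition incid (o : idx -> seq vec) (l k : idx) : int :=
  if pdec (codim1 l k) then
    (if pdec (exists v, cone l v /\ ~ aff k v /\ same_orient (v :: o k) (o l))
     then 1 else -1)
  else 0.

(* chains of the complex whose cells are indexed by D = Gamma \ Gamma' *)
Definition is_chain (D : idx -> Prop) (i : nat) (c : idx -> S) : Prop :=
  forall k, c k <> 0 -> D k /\ cdim k = i.

Definition dmap (o : idx -> seq vec) (D : idx -> Prop) (c : idx -> S) (k : idx) : S :=
  \sum_(l : idx | pdec (D l)) (incid o l k)%:~R * c l.

(* homology of the complex with entries S/A(k) in the cell k *)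
Definition hcycle (o : idx -> seq vec) (D : idx -> Prop) (A : idx -> S -> Prop)
  (i : nat) (c : idx -> S) : Prop :=
  is_chain D i c /\ forall k, D k -> (cdim k).+1 = i -> A k (dmap o D c k).

Definition hbound (o : idx -> seq vec) (D : idx -> Prop) (A : idx -> S -> Prop)
  (i : nat) (c : idx -> S) : Prop :=
  exists b, is_chain D i.+1 b /\
    forall k, D k -> cdim k = i -> A k (c k - dmap o D b k).

Definition prime_ideal (P : S -> Prop) : Prop :=
  P 0 /\ (forall a b, P a -> P b -> P (a + b)) /\ (forall a b, P b -> P (a * b)) /\
  ~ P 1 /\ (forall a b, P (a * b) -> P a \/ P b).

Definition ass_H (o : idx -> seq vec) (D : idx -> Prop) (A : idx -> S -> Prop)
  (i : nat) (P : S -> Prop) : Prop :=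
  prime_ideal P /\ exists c, hcycle o D A i c /\
    forall f, P f <-> hbound o D A i (fun k => f * c k).

Definition H_zero (o : idx -> seq vec) (D : idx -> Prop) (A : idx -> S -> Prop)
  (i : nat) : Prop :=
  forall c, hcycle o D A i c -> hbound o D A i c.

Definition ass_RJ (alpha : idx -> int) (o : idx -> seq vec) (i : nat) (P : S -> Prop) :=
  ass_H o (fun k => ~ Sm1 alpha k) (Jid alpha (fun _ => True) (Sm1 alpha)) i P.

Definition H_R_WS_zero (alpha : idx -> int) (o : idx -> seq vec) (W : vec -> Prop)
  (s : idx) (i : nat) :=
  H_zero o (fun k => SigmaW W s k /\ ~ Sm1W alpha W s k) (fun _ f => f = 0) i.

End FanDefs.

(* Main.v *)
Require Import Defs.
From HB Require Import structures.
From mathcomp Require Import all_boot all_order all_algebra.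
From mathcomp Require Import reals.
From mathcomp Require Import perm mpoly ring.
From Stdlib Require Import Classical ClassicalEpsilon.
Import Order.TTheory GRing.Theory Num.Theory.
Local Open Scope ring_scope.

(** Let [P] be the annihilator of a homology class and [W] the intersection of the
    hyperplanes [aff t] whose linear form lies in [P].  A cell not spanning [W] lies in
    an [n]-face [t] whose form is not in [P], so its summand is killed by an element
    outside [P]; the remaining cells split, by heredity, into the classes
    [SigmaW W s], and [P] being prime is the annihilator of a component in one class.
    There every [J k] is invariant under translation by [W], so induction on finite
    differences shows that no polynomial outside [I(W)] kills a nonzero class killed by
    [I(W)]; hence [P = I(W)].  If [dim W >= i], the cells of dimension [i] span
    exactly [W] and each is the only such face of some cell of dimension [i + 1], so the
    homology vanishes.  If [dim W = i - 1], the same remark shows that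
    [J_i -> J_(i-1)] is onto, and a cycle can be lifted to a cycle of the constant
    complex.  In the simplicial case all cells of a class contain a common cell [g] with
    [W] inside [aff g]; translation invariance along [aff g] forces [W = aff g], and
    when [dim g = i - 1] the constant complex is acyclic in degree [i] because the star
    of [g] is connected. *)

Set Implicit Arguments.
Unset Strict Implicit.
Unset Printing Implicit Defensive.

(** * Polynomials and ideals of subspaces *)

Lemma pdecP (P : Prop) : reflect P (pdec P).
Proof.
by rewrite /pdec; case: excluded_middle_informative => h; constructor.
Qed.

(** [muni] singles out the last variable; no coefficient of [p] is lost, so [muni p = 0] forces
    [p = 0]. *)
Lemma mcoeff_muni (R : comNzRingType) n (p : {mpoly R[n.+1]}) (m : 'X_{1..n.+1}) :
  ((muni p)`_(m ord_max))@_[multinom m (widen_ord (leqnSn n) i) | i < n] = p@_m.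
Proof.
rewrite muniE coef_sum raddf_sum /=.
have E (m' : 'X_{1..n.+1}) :
  ((p@_m' *: 'X_[[multinom m' (widen_ord (leqnSn n) i) | i < n]] *: 'X^(m' ord_max))`_(m ord_max))
   @_[multinom m (widen_ord (leqnSn n) i) | i < n] = p@_m' * (m' == m)%:R.
  rewrite coefZ coefXn; case: (eqVneq m' m) => [->|ne].
    by rewrite eqxx mulr1 mcoeffZ mcoeffX eqxx.
  case: eqP => [e1|_]; last by rewrite mulr0 mcoeff0 mulr0.
  rewrite mulr1 mcoeffZ mcoeffX; case: eqP => [/mnmP e2|_] //.
  case/eqP: ne; apply/mnmP => i; case: (unliftP ord_max i) => [j ->|-> //].
  have := e2 j; rewrite !mnmE => e3.
  suff -> : lift ord_max j = widen_ord (leqnSn n) j by [].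
  by apply/val_inj; rewrite /= /bump leqNgt ltn_ord.
under eq_bigr => m' _ do rewrite E.
have [mp|mp] := boolP (m \in msupp p).
  rewrite (bigD1_seq m) ?msupp_uniq //= eqxx mulr1 big1 ?addr0 // => m' /negbTE ->.
  by rewrite mulr0.
rewrite big1_seq ?memN_msupp_eq0 // => m' /= m'p.
by case: eqP => [e|_]; rewrite ?mulr0 //; rewrite e (negbTE mp) in m'p.
Qed.

Lemma meval_muni (R : comNzRingType) n (p : {mpoly R[n.+1]}) (v : 'I_n.+1 -> R) :
  p.@[v] = (map_poly (meval (fun i => v (widen_ord (leqnSn n) i))) (muni p)).[v ord_max].
Proof.
rewrite muniE raddf_sum horner_sum [in LHS](mpolyE p) raddf_sum /=.
apply: eq_bigr => m _.
rewrite mevalZ mevalX map_polyZ hornerZ map_polyXn hornerXn /=.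
rewrite mevalZ mevalX -mulrA big_ord_recr /=; congr (_ * (_ * _)).
by apply: eq_bigr => i _; rewrite mnmE.
Qed.

(** Induction on the number of variables: once all variables but the last are specialised, a
    univariate polynomial vanishes at all natural numbers, which are distinct in [R]. So the
    coefficients of [muni p] vanish everywhere. *)
Lemma mpoly_vanish (R : numDomainType) n (p : {mpoly R[n]}) :
  (forall v, p.@[v] = 0) -> p = 0.
Proof.
elim: n p => [|n IH] p p0.
  have e : p = (p@_0%MM)%:MP.
    apply/mpolyP => m; have -> : m = 0%MM by apply/mnmP; case.
    by rewrite mcoeffC eqxx mulr1.
  by have := p0 (fun=> 0); rewrite e mevalC => ->; rewrite mpolyC0.
suff mp0 : muni p = 0.
  by apply/mpolyP => m; rewrite -mcoeff_muni mp0 coef0 !mcoeff0.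
apply/polyP => j; rewrite coef0; apply: IH => v.
set q := map_poly (meval v) (muni p).
have q0 t : q.[t] = 0.
  pose v' (i : 'I_n.+1) := if unlift ord_max i is Some i' then v i' else t.
  have := p0 v'; rewrite meval_muni {2}/v' unlift_none => <-.
  congr horner; apply/polyP => k; rewrite !coef_map /=; apply: meval_eq => i.
  rewrite /v'; have -> : widen_ord (leqnSn n) i = lift ord_max i.
    by apply/val_inj; rewrite /= /bump leqNgt ltn_ord.
  by rewrite liftK.
suff : q = 0 by move/polyP => /(_ j); rewrite coef_map coef0.
apply/eqP; apply/negP => /negP nz.
have := max_poly_roots (rs := [seq k%:R | k <- iota 0 (size q)]) nz.
rewrite size_map size_iota ltnn; suff [h1 h2] : all (root q) [seq k%:R | k <- iota 0 (size q)]
  /\ uniq [seq (k%:R : R) | k <- iota 0 (size q)] by move/(_ h1 h2).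
split; first by apply/allP => x _; rewrite /root q0.
by rewrite map_inj_uniq ?iota_uniq // => a b /eqP; rewrite eqr_nat => /eqP.
Qed.

Section Polynomials.
Variables (R : realType) (n : nat).
Local Notation vec := 'rV[R]_(n.+1).
Local Notation S := {mpoly R[n.+1]}.

Definition ev (x : vec) (f : S) : R := f.@[fun j => x 0 j].

Lemma mpoly_ext (f g : S) : (forall x, ev x f = ev x g) -> f = g.
Proof.
move=> e; apply/eqP; rewrite -subr_eq0; apply/eqP; apply: mpoly_vanish => v.
have := e (\row_j v j); rewrite /ev mevalB => /eqP.
rewrite -subr_eq0 => /eqP <-.
by congr (_ - _); apply: meval_eq => j; rewrite mxE.
Qed.

Definition transl (w : vec) : S -> S :=
  comp_mpoly [tuple 'X_j + (w 0 j)%:MP | j < n.+1].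
HB.instance Definition _ w := GRing.RMorphism.on (transl w).

Lemma ev_transl w f x : ev x (transl w f) = ev (x + w) f.
Proof.
rewrite /ev /transl comp_mpoly_meval; apply: meval_eq => j.
by rewrite tnth_mktuple mevalD mevalXU mevalC mxE.
Qed.

Definition pullback (M : 'M[R]_n.+1) : S -> S :=
  comp_mpoly [tuple \sum_k M k j *: 'X_k | j < n.+1].
HB.instance Definition _ M := GRing.RMorphism.on (pullback M).

Lemma ev_pullback M f x : ev x (pullback M f) = ev (x *m M) f.
Proof.
rewrite /ev /pullback comp_mpoly_meval; apply: meval_eq => j.
rewrite tnth_mktuple raddf_sum mxE; apply: eq_bigr => k _ /=.
by rewrite mevalZ mevalXU mulrC.
Qed.

Lemma ev_linform u x : ev x (linform u) = dotv u x.
Proof.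
rewrite /ev /linform raddf_sum; apply: eq_bigr => j _ /=.
by rewrite mevalZ mevalXU.
Qed.

Lemma ev0 x : ev x 0 = 0. Proof. exact: meval0. Qed.
Lemma evD x f g : ev x (f + g) = ev x f + ev x g. Proof. exact: mevalD. Qed.
Lemma evB x f g : ev x (f - g) = ev x f - ev x g. Proof. exact: mevalB. Qed.
Lemma evM x f g : ev x (f * g) = ev x f * ev x g. Proof. exact: mevalM. Qed.
Lemma evC x a : ev x a%:MP = a. Proof. exact: mevalC. Qed.

Lemma dotvE (u x : vec) : dotv u x = (x *m u^T) 0 0.
Proof. by rewrite mxE; apply: eq_bigr => j _; rewrite mxE mulrC. Qed.
Lemma dotvDr (u x y : vec) : dotv u (x + y) = dotv u x + dotv u y.
Proof. by rewrite !dotvE mulmxDl mxE. Qed.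
Lemma dotvZr (u : vec) a (x : vec) : dotv u (a *: x) = a * dotv u x.
Proof. by rewrite !dotvE -scalemxAl mxE. Qed.
Lemma dotvDl (u v x : vec) : dotv (u + v) x = dotv u x + dotv v x.
Proof. by rewrite !dotvE linearD mulmxDr mxE. Qed.
Lemma dotvZl (u : vec) a (x : vec) : dotv (a *: u) x = a * dotv u x.
Proof. by rewrite !dotvE linearZ -scalemxAr mxE. Qed.

Lemma dotv_coordB (M : 'M[R]_n.+1) j x :
  dotv (delta_mx 0 j - (col j M)^T) x = x 0 j - (x *m M) 0 j.
Proof.
rewrite -[- _]scaleN1r dotvDl dotvZl mulN1r; congr (_ - _).
  by rewrite dotvE trmx_delta -colE mxE.
by rewrite dotvE trmxK !mxE; apply: eq_bigr => k _; rewrite !mxE.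
Qed.

Lemma transl_linform w u : dotv u w = 0 -> transl w (linform u) = linform u.
Proof.
by move=> e; apply: mpoly_ext => x; rewrite ev_transl !ev_linform dotvDr e addr0.
Qed.

(** Killed by any [N] successive finite differences. This plays the role of a degree bound and
    decreases under differences by construction. *)
Fixpoint nilord (N : nat) (f : S) : Prop :=
  if N is N'.+1 then forall w, nilord N' (transl w f - f) else f = 0.

Lemma nilordD N f g : nilord N f -> nilord N g -> nilord N (f + g).
Proof.
elim: N f g => [|N IH] f g /= hf hg; first by rewrite hf hg addr0.
by move=> w; rewrite rmorphD opprD addrACA; apply: IH; [apply: hf | apply: hg].
Qed.

Lemma nilordW N f : nilord N f -> nilord N.+1 f.
Proof.
elim: N f => [f -> w|N IH f hf w]; first by rewrite rmorph0 subr0.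
by apply: IH; apply: hf.
Qed.

Lemma nilord_le M N f : (M <= N)%N -> nilord M f -> nilord N f.
Proof. by move/subnK => <-; elim: (N - M)%N => // k IH /IH; apply: nilordW. Qed.

Lemma nilordC N a f : nilord N f -> nilord N (a%:MP * f).
Proof.
elim: N f => [|N IH] f /= hf; first by rewrite hf mulr0.
move=> w; suff -> : transl w (a%:MP * f) - a%:MP * f = a%:MP * (transl w f - f).
  by apply: IH; apply: hf.
by rewrite rmorphM /= [transl w a%:MP]comp_mpolyC mulrBr.
Qed.

Lemma transl_var w j : transl w 'X_j = 'X_j + (w 0 j)%:MP.
Proof.
by apply: mpoly_ext => x; rewrite ev_transl evD /ev !mevalXU mxE mevalC.
Qed.

(** Product rule: a difference of ['X_j * f] is ['X_j] times a difference of [f] plus a scalar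
    multiple of a translate of [f]. *)
Lemma nilordX N j f : nilord N f -> nilord N.+1 ('X_j * f).
Proof.
elim: N f => [|N IH] f hf; first by move=> w; rewrite (hf : f = 0) mulr0 rmorph0 subr0.
move=> w; have -> : transl w ('X_j * f) - 'X_j * f =
   'X_j * (transl w f - f) + (w 0 j)%:MP * (f + (transl w f - f)).
  by rewrite rmorphM /= transl_var; ring.
by apply: nilordD; [apply/IH/hf | apply/nilordC/nilordD => //; apply/nilordW/hf].
Qed.

Lemma nilord_exists (f : S) : exists N, nilord N f.
Proof.
elim/mpolyind: f => [|c m p _ _ [N hN]]; first by exists 0%N.
have [M hM] : exists M, nilord M (c *: 'X_[m] : S).
  rewrite -mul_mpolyC mpolyXE_id.
  suff [M hM] : exists M, nilord M (\prod_(i < n.+1) 'X_i ^+ m i * 1 : S).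
    by exists M; apply: nilordC; rewrite mulr1 in hM.
  (* Multiplication by [p] keeps the order finite; this property is stable under products and holds
     for variables. *)
  pose Q (p : S) := forall f, (exists M, nilord M f) -> exists M, nilord M (p * f).
  have h1 : exists M, nilord M (1 : S) by exists 1%N => w; rewrite rmorph1 subrr.
  suff : Q (\prod_(i < n.+1) 'X_i ^+ m i) by apply.
  have QM p1 p2 : Q p1 -> Q p2 -> Q (p1 * p2).
    by move=> q1 q2 f hf; rewrite -mulrA; apply/q1/q2.
  have Q1 : Q 1 by move=> f hf; rewrite mul1r.
  apply: big_ind => // i _; elim: (m i) => // k IH; rewrite exprS; apply: QM => // f [M hM].
  by exists M.+1; apply: nilordX.
exists (maxn M N); apply: nilordD; [apply: nilord_le hM | apply: nilord_le hN].
  exact: leq_maxl.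
exact: leq_maxr.
Qed.

(** * Ideals of linear subspaces *)

Section Subspace.
Variables (m : nat) (A : 'M[R]_(m, n.+1)).

Definition rowsp (x : vec) : Prop := (x <= A)%MS.

(** [pinvmx A *m A] projects onto the row space of [A], so the ideal is the kernel of a ring
    morphism into a domain; primality follows. *)
Lemma idealW_pullback (f : S) :
  idealW rowsp f <-> pullback (pinvmx A *m A) f = 0.
Proof.
split=> [h|h x hx].
  apply: mpoly_ext => x; rewrite ev_pullback ev0; apply: h.
  by rewrite /rowsp mulmxA submxMl.
have := ev_pullback (pinvmx A *m A) f x; rewrite h ev0 mulmxA mulmxKpV //.
Qed.

Lemma idealW_prime (f g : S) :
  idealW rowsp (f * g) -> idealW rowsp f \/ idealW rowsp g.
Proof.
by rewrite !idealW_pullback rmorphM /= => /eqP; rewrite mulf_eq0 => /orP[]/eqP; [left|right].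
Qed.

Lemma idealW_transl w (f : S) : rowsp w -> idealW rowsp f -> idealW rowsp (transl w f).
Proof.
by move=> hw h x hx; rewrite -/(ev x _) ev_transl; apply: h; apply: addmx_sub.
Qed.

(* If [f] kills the class of [c], then [f * transl w f] kills that of its finite
   difference in the direction [w]; so the difference order of [c] drops, and once
   every difference of [c] is trivial, the differences of [f] kill [c] as well. *)
Lemma idealW_torsion_free (I : Type) (B : (I -> S) -> Prop)
    (Bext : forall c c', c =1 c' -> B c -> B c')
    (BD : forall c c', B c -> B c' -> B (fun k => c k + c' k))
    (BM : forall f c, B c -> B (fun k => f * c k))
    (BT : forall w c, rowsp w -> B c -> B (fun k => transl w (c k)))
    (N : nat) (c : I -> S) (f : S) :
  (forall k, nilord N (c k)) ->
  (forall g, idealW rowsp g -> B (fun k => g * c k)) ->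
  ~ idealW rowsp f -> B (fun k => f * c k) -> B c.
Proof.
have BB c1 c2 : B c1 -> B c2 -> B (fun k => c1 k - c2 k).
  move=> h1 h2; have := BD _ _ h1 (BM (-1) _ h2).
  by apply: Bext => k; rewrite mulN1r.
elim: N c f => [|N IH] c f nc Ic nf Bf.
  by apply: Bext Bf => k; rewrite (nc k) mulr0.
have Bdiff w : rowsp w -> B (fun k => transl w (c k) - c k).
  move=> hw; apply: (IH _ (f * transl w f)) => [k|g hg||].
  - exact: nc.
  - have hw' : rowsp (- w) by rewrite /rowsp eqmx_opp.
    have := BB _ _ (BT w _ hw (Ic _ (idealW_transl hw' hg))) (Ic _ hg).
    apply: Bext => k; rewrite rmorphM mulrBr; congr (_ * _ - _).
    by apply: mpoly_ext => x; rewrite !ev_transl addrK.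
  - case/idealW_prime => // h; apply: nf => x hx.
    have hxw : rowsp (x - w) by rewrite /rowsp addmx_sub // eqmx_opp.
    by have := h _ hxw; rewrite -/(ev _ _) ev_transl subrK.
  - have := BB _ _ (BM f _ (BT w _ hw Bf)) (BM (transl w f) _ Bf).
    by apply: Bext => k; rewrite rmorphM /=; ring.
have [K hK] := nilord_exists f; elim: K f hK nf Bf => [|K IHK] f hK nf Bf.
  by case: nf => x _; rewrite hK; apply: meval0.
case: (classic (exists w, rowsp w /\ ~ idealW rowsp (transl w f - f))) => [[w [hw nw]]|h].
  apply: (IHK (transl w f - f)) => //.
  have := BB _ _ (BB _ _ (BT w _ hw Bf) Bf) (BM (transl w f) _ (Bdiff w hw)).
  by apply: Bext => k; rewrite rmorphM /=; ring.
(* Now every difference of [f] along the subspace lies in the ideal, so [f] is constant there.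
   Modulo the ideal it is a nonzero scalar, which can be inverted. *)
have hc w : rowsp w -> ev w f = ev 0 f.
  move=> hw; apply: NNPP => ne; apply: h; exists w; split => // /(_ 0) h0.
  apply: ne; have : rowsp 0 by rewrite /rowsp sub0mx.
  by move/h0; rewrite -/(ev _ _) evB ev_transl add0r => /eqP; rewrite subr_eq0 => /eqP.
have f0 : ev 0 f != 0 by apply/eqP => e; apply: nf => w /hc; rewrite e.
have hI : idealW rowsp (f - (ev 0 f)%:MP).
  by move=> w hw; rewrite -/(ev _ _) evB evC hc // subrr.
have := BM (ev 0 f)^-1%:MP _ (BB _ _ Bf (Ic _ hI)).
apply: Bext => k; rewrite -mulrBl opprB addrCA subrr addr0 mulrA.
by rewrite -mpolyCM mulVf // mpolyC1 mul1r.
Qed.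

(** The polynomials congruent to their pullback modulo [P] contain the constants and are closed
    under sums and products, so testing variables is enough. *)
Lemma ideal_congr_pullback (P : S -> Prop) (M : 'M[R]_n.+1) :
  P 0 -> (forall a b, P a -> P b -> P (a + b)) -> (forall a b, P b -> P (a * b)) ->
  (forall j, P ('X_j - pullback M 'X_j)) -> forall f, P (f - pullback M f).
Proof.
move=> P0 PD PM PX.
have QM f g : P (f - pullback M f) -> P (g - pullback M g) -> P (f * g - pullback M (f * g)).
  move=> hf hg; have := PD _ _ (PM g _ hf) (PM (pullback M f) _ hg).
  by congr P; rewrite rmorphM /=; ring.
have QC a : P (a%:MP - pullback M a%:MP) by rewrite [pullback M _]comp_mpolyC subrr.
elim/mpolyind => [|c p f _ _ hf]; first by rewrite rmorph0 subrr.
have -> : c *: 'X_[p] + f - pullback M (c *: 'X_[p] + f) =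
   (c *: 'X_[p] - pullback M (c *: 'X_[p])) + (f - pullback M f).
  by rewrite rmorphD opprD addrACA.
apply: PD => //; rewrite -mul_mpolyC; apply: (QM) => //; rewrite mpolyXE_id.
have Q1 : P (1 - pullback M 1) by rewrite rmorph1 subrr.
apply: (big_ind (fun f => P (f - pullback M f))) => // i _.
by elim: (p i) => // k IH; rewrite exprS; apply: QM.
Qed.

Lemma linformZD a u v : linform (a *: u + v) = a%:MP * linform u + linform v :> S.
Proof.
by apply: mpoly_ext => x; rewrite evD evM evC !ev_linform dotvDl dotvZl.
Qed.

(** Linear forms generate the ideal of a subspace: for a projection [M] onto it, an [f] vanishing
    there equals [f - pullback M f], which lies in the ideal of the forms
    ['X_j - pullback M 'X_j]. *)
Lemma idealW_sub_ideal (P : S -> Prop) (I : finType) (U : I -> vec) :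
  P 0 -> (forall a b, P a -> P b -> P (a + b)) -> (forall a b, P b -> P (a * b)) ->
  (forall i, P (linform (U i))) ->
  (forall x, (forall i, dotv (U i) x = 0) -> rowsp x) ->
  forall f, idealW rowsp f -> P f.
Proof.
move=> P0 PD PM PU hU.
have Plin u : (forall x, rowsp x -> dotv u x = 0) -> P (linform u).
  move=> hu; pose Um := \matrix_(i < #|I|) U (enum_val i).
  have : (u <= Um)%MS.
    rewrite submxE; apply/eqP/rowP => j; rewrite [RHS]mxE.
    have hr : rowsp (col j (cokermx Um))^T.
      apply: hU => i; rewrite dotvE -trmx_mul mxE.
      have := mulmx_coker Um => /matrixP /(_ (enum_rank i) j); rewrite [RHS]mxE => <-.
      rewrite !mxE; apply: eq_bigr => k _; rewrite !mxE enum_rankK //.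
    have := hu _ hr; rewrite dotvE -trmx_mul mxE => <-.
    by rewrite !mxE; apply: eq_bigr => k _; rewrite !mxE.
  case/submxP => D ->; rewrite mulmx_sum_row.
  have L0 : linform 0 = 0 :> S.
    by apply: mpoly_ext => x; rewrite ev_linform ev0 dotvE linear0 mulmx0 mxE.
  apply: (big_ind (fun v => P (linform v))) => [|u1 u2 h1 h2|i _].
  - by rewrite L0.
  - by rewrite -[u1]scale1r linformZD; apply: (PD) => //; apply: PM.
  - by rewrite -[_ *: _]addr0 linformZD L0 addr0 rowK; apply: PM.
move=> f; rewrite idealW_pullback => hf.
rewrite -[f]subr0 -hf; apply: ideal_congr_pullback => // j.
set M := pinvmx A *m A.
have -> : 'X_j - pullback M 'X_j = linform (delta_mx 0 j - (col j M)^T) :> S.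
  apply: mpoly_ext => x; rewrite evB ev_pullback ev_linform /ev !mevalXU.
  by rewrite dotv_coordB.
apply: Plin => x hx; rewrite dotv_coordB /M mulmxA mulmxKpV // subrr //.
Qed.
End Subspace.
End Polynomials.

(** * Cones and their faces *)

Section Cones.
Variables (R : realType) (n : nat).
Local Notation vec := 'rV[R]_(n.+1).

Definition seqmx (B : seq vec) : 'M[R]_(size B, n.+1) := \matrix_(j < size B) B`_j.

Lemma lincombE (B : seq vec) c : lincomb B c = (\row_(j < size B) c j) *m seqmx B.
Proof.
rewrite mulmx_sum_row; apply: eq_bigr => j _.
by rewrite rowK mxE.
Qed.

Definition coef_of m (D : 'rV[R]_m) (j : nat) : R :=
  if insub j is Some i then D 0 i else 0.

Lemma coef_ofE m (D : 'rV[R]_m) (j : 'I_m) : coef_of D j = D 0 j.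
Proof. by rewrite /coef_of valK. Qed.

Lemma row_coef_of m (D : 'rV[R]_m) : \row_(j < m) coef_of D j = D.
Proof. by apply/rowP => j; rewrite mxE coef_ofE. Qed.

Lemma in_spanE (B : seq vec) x : in_span B x <-> (x <= seqmx B)%MS.
Proof.
split=> [[c ->]|/submxP[D ->]]; first by rewrite lincombE submxMl.
by exists (coef_of D); rewrite lincombE row_coef_of.
Qed.

Lemma lin_indepE (B : seq vec) : lin_indep B <-> row_free (seqmx B).
Proof.
split=> [h|h c].
  rewrite -kermx_eq0; apply/rowV0P => D /sub_kermxP e.
  apply/rowP => j; rewrite [RHS]mxE -coef_ofE; apply: h => //.
  by rewrite lincombE row_coef_of.
rewrite lincombE -[0](mul0mx _ (seqmx B)) => /(row_free_inj h) /rowP e j hj.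
by have := e (Ordinal hj); rewrite !mxE.
Qed.

Lemma dimW_rank (W : vec -> Prop) m (A : 'M[R]_(m, n.+1)) d :
  (forall x, W x <-> (x <= A)%MS) -> dimW W d <-> d = \rank A.
Proof.
move=> hA; split=> [[B [<- [/lin_indepE hB sB]]]|->].
  rewrite -(eqP hB); apply/eqP; rewrite eqn_leq; apply/andP; split; apply: mxrankS.
    by apply/rV_subP => v hv; apply/hA/sB/in_spanE.
  by apply/rV_subP => v /hA/sB/in_spanE.
pose B := [seq row i (row_base A) | i <- enum 'I_(\rank A)].
have sB : size B = \rank A by rewrite size_map size_enum_ord.
exists B; split=> //.
have nB (i : 'I_(\rank A)) : B`_i = row i (row_base A).
  by rewrite (nth_map i) ?size_enum_ord // nth_ord_enum.
have eB : (seqmx B :=: row_base A)%MS.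
  apply/eqmxP/andP; split; apply/row_subP => i.
    have hi : (i < \rank A)%N by rewrite -sB.
    by rewrite rowK (nB (Ordinal hi)) row_sub.
  have hi : (i < size B)%N by rewrite sB.
  by rewrite -nB -[B`_i](rowK (fun j : 'I_(size B) => B`_j) (Ordinal hi)) row_sub.
split; first by apply/lin_indepE; rewrite /row_free eB sB eq_row_base.
by move=> x; rewrite hA in_spanE eB eq_row_base.
Qed.

Lemma dotv_span (v : vec) m (A : 'M[R]_(m, n.+1)) :
  (forall j, dotv v (row j A) = 0) -> forall x, (x <= A)%MS -> dotv v x = 0.
Proof.
move=> h x /submxP[D ->]; rewrite mulmx_sum_row.
apply: (big_ind (fun y => dotv v y = 0)) => [|y z hy hz|j _].
- by rewrite dotvE mul0mx mxE.
- by rewrite dotvDr hy hz addr0.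
- by rewrite dotvZr h mulr0.
Qed.

(** The columns of [cokermx A] are forms cutting out the row space; one of them is nonzero at
    [x]. *)
Lemma separating_form m (A : 'M[R]_(m, n.+1)) (x : vec) : ~~ (x <= A)%MS ->
  exists v : vec, (forall y : vec, (y <= A)%MS -> dotv v y = 0) /\ dotv v x != 0.
Proof.
rewrite submxE => hx.
have [j hj] : exists j, (x *m cokermx A) 0 j != 0.
  apply/existsP; apply: contraR hx; rewrite negb_exists => /forallP h.
  by apply/eqP/rowP => j; rewrite [RHS]mxE; apply/eqP; have := h j; rewrite negbK.
have e y : dotv (col j (cokermx A))^T y = (y *m cokermx A) 0 j.
  by rewrite dotvE trmxK !mxE; apply: eq_bigr => k _; rewrite !mxE.
exists (col j (cokermx A))^T; split; last by rewrite e.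
by move=> y; rewrite submxE e => /eqP ->; rewrite mxE.
Qed.

Lemma pos_hull_span (g : seq vec) x : pos_hull g x -> (x <= seqmx g)%MS.
Proof. by case=> c [_ ->]; rewrite lincombE submxMl. Qed.

Lemma gen_pos_hull (g : seq vec) (j : 'I_(size g)) : pos_hull g g`_j.
Proof.
exists (fun k => (k == j :> nat)%:R); split=> [k|]; first exact: ler0n.
rewrite /lincomb (bigD1 j) //= eqxx scale1r big1 ?addr0 // => k /negbTE.
by rewrite -(inj_eq val_inj) /= => ->; rewrite scale0r.
Qed.

Lemma dotv_lincomb (u : vec) (g : seq vec) c :
  dotv u (lincomb g c) = \sum_(j < size g) c j * dotv u g`_j.
Proof.
rewrite /lincomb; elim/big_ind2: _ => [|x a y b <- <-|j _].
- by rewrite dotvE mul0mx mxE.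
- by rewrite dotvDr.
- by rewrite dotvZr.
Qed.

Lemma pos_hull_nonneg (u : vec) (g : seq vec) :
  (forall j : 'I_(size g), 0 <= dotv u g`_j) -> forall x, pos_hull g x -> 0 <= dotv u x.
Proof.
move=> h x [c [hc ->]]; rewrite dotv_lincomb; apply: sumr_ge0 => j _.
by rewrite mulr_ge0.
Qed.

(** A pair holds the values of two forms at a generator of a cone. This gives the room needed to
    tilt a supporting hyperplane without losing strict positivity. *)
Lemma small_perturbation (s : seq (R * R)) :
  exists2 e : R, 0 < e & forall e', 0 < e' <= e ->
    forall p, p \in s -> 0 < p.1 -> 0 < p.1 + e' * p.2.
Proof.
elim: s => [|[a b] s [e e0 IH]]; first by exists 1.
pose d := a / (`|b| + 1); have b1 : 0 < `|b| + 1 by rewrite ltr_wpDl.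
exists (if 0 < a then Num.min e d else e).
  by case: ifP => // a0; rewrite lt_min e0 divr_gt0.
move=> e' /andP[e'0 e'e] p; rewrite inE => /orP[/eqP -> /= a0|ps].
  rewrite a0 le_min in e'e; case/andP: e'e => _ e'd.
  rewrite -ltrBlDr sub0r; apply: le_lt_trans (_ : e' * `|b| < a).
    by rewrite -mulrN ler_pM2l // ler_normr lexx orbT.
  rewrite -(ler_pM2r b1) /d divfK ?gt_eqF // in e'd.
  by apply: lt_le_trans e'd; rewrite ltr_pM2l // ltrDl.
apply: IH => //; rewrite e'0 /=; apply: le_trans e'e _.
by case: ifP => // _; rewrite ge_min lexx.
Qed.

(** * Faces of the cones of a fan *)

Section Fan.
Variable F : seq (seq vec).
Local Notation idx := 'I_(size F).
Hypothesis fanF : is_fan F.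

Definition cellmx (k : idx) := seqmx (gens k).

Lemma affE (k : idx) x : aff k x <-> (x <= cellmx k)%MS.
Proof. exact: in_spanE. Qed.

Lemma cdimE (k : idx) : cdim k = \rank (cellmx k). Proof. by []. Qed.

Lemma cone_aff (k : idx) x : cone k x -> aff k x.
Proof. by move/pos_hull_span; rewrite affE. Qed.

Lemma cone_gen (k : idx) (j : 'I_(size (gens k))) : cone k (gens k)`_j.
Proof. exact: gen_pos_hull. Qed.

Lemma cell_sub (k l : idx) : set_sub (cone k) (cone l) -> (cellmx k <= cellmx l)%MS.
Proof.
by move=> h; apply/row_subP => j; rewrite rowK; apply/affE/cone_aff/h/cone_gen.
Qed.

Lemma aff_sub (k l : idx) : set_sub (cone k) (cone l) -> set_sub (aff k) (aff l).
Proof. by move/cell_sub => h x /affE hx; apply/affE; apply: submx_trans h. Qed.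

Lemma cdim_sub (k l : idx) : set_sub (cone k) (cone l) -> (cdim k <= cdim l)%N.
Proof. by move/cell_sub/mxrankS. Qed.

Lemma cdim_max (k : idx) : (cdim k <= n.+1)%N.
Proof. exact: rank_leq_col. Qed.

Lemma dotv_aff0 (v : vec) (k : idx) :
  (forall x, cone k x -> dotv v x = 0) -> forall x, aff k x -> dotv v x = 0.
Proof.
move=> h x /affE; apply: dotv_span => j; rewrite rowK.
exact/h/cone_gen.
Qed.

Lemma subcell_face (k l : idx) : set_sub (cone k) (cone l) ->
  exists u : vec, (forall x, cone l x -> 0 <= dotv u x) /\
     (forall x, cone k x <-> (cone l x /\ dotv u x = 0)).
Proof.
move=> kl; case: fanF => _ [hI _]; have [_ [u [hu e]]] := hI k l.
exists u; split=> // x; rewrite -e; split=> [hx|[] //].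
by split=> //; apply: kl.
Qed.

Lemma face_cell (l : idx) (u : vec) :
  (forall j : 'I_(size (gens l)), 0 <= dotv u (gens l)`_j) ->
  exists k : idx, forall x, cone k x <-> (cone l x /\ dotv u x = 0).
Proof.
move=> hu; case: fanF => hf _; apply: (hf l (fun x => cone l x /\ dotv u x = 0)).
exists u; split=> [|x]; last by [].
exact: pos_hull_nonneg.
Qed.

Lemma cell_cap (k l : idx) : exists m : idx, forall x, cone m x <-> (cone k x /\ cone l x).
Proof.
case: fanF => hf [hI _]; have [h _] := hI k l.
exact: hf h.
Qed.

Lemma cell_eq (k l : idx) :
  set_sub (cone k) (cone l) -> set_sub (cone l) (cone k) -> k = l.
Proof.
move=> kl lk; case: fanF => _ [_ h]; apply: h => x.
by split; [apply: kl | apply: lk].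
Qed.

(** The form cutting the face [k] out of [l] vanishes on the whole span of [k]. *)
Lemma subcell_aff (k l : idx) x :
  set_sub (cone k) (cone l) -> cone l x -> aff k x -> cone k x.
Proof.
move=> kl lx kx; have [u [_ hu]] := subcell_face kl; apply/hu; split=> //.
by apply: dotv_aff0 kx => y /hu[].
Qed.

Lemma subcell_eq (k l : idx) :
  set_sub (cone k) (cone l) -> (cdim l <= cdim k)%N -> k = l.
Proof.
move=> kl dl; apply: cell_eq => // x lx; apply: (subcell_aff kl lx).
apply/affE; have := mxrank_leqif_sup (cell_sub kl) => -[_ e].
apply: submx_trans (_ : cellmx l <= cellmx k)%MS; first exact/affE/cone_aff.
by rewrite -e eqn_leq -!cdimE dl cdim_sub.
Qed.

(* Rotate a hyperplane supporting [l] along [k] about the span of [k] and [x0]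
   until it meets a new generator of [l]. *)
Lemma enlarge_face (k l : idx) (x0 : vec) :
  set_sub (cone k) (cone l) -> ~ aff k x0 -> ((cdim k).+1 < cdim l)%N ->
  exists l' : idx, [/\ set_sub (cone k) (cone l'), set_sub (cone l') (cone l),
               (cdim k < cdim l')%N & ~ aff l' x0].
Proof.
move=> kl nx0 dkl; pose g j := (gens l)`_j.
(* If the form supporting [k] vanishes at [x0], it is tilted slightly by a form that vanishes on
   [aff k] but not at [x0]. *)
have [u [u0 [uk ux0]]] : exists u, (forall j : 'I_(size (gens l)), 0 <= dotv u (g j) /\
     (dotv u (g j) = 0 -> aff k (g j))) /\ (forall x, aff k x -> dotv u x = 0) /\ dotv u x0 != 0.
  have [u [upos hu]] := subcell_face kl.
  have uk : forall x, aff k x -> dotv u x = 0 by apply: dotv_aff0 => x /hu[].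
  have [e|ne] := eqVneq (dotv u x0) 0; last first.
    exists u; split=> // j; split=> [|e0]; first exact/upos/cone_gen.
    by apply/cone_aff/hu; split=> //; apply: cone_gen.
  have [|v [vk vx0]] := separating_form (A := cellmx k) (x := x0).
    by apply/negP => /affE.
  have [ee ee0 hee] := small_perturbation
     [seq (dotv u (g (val j)), dotv v (g (val j))) | j <- enum 'I_(size (gens l))].
  have gk (j : 'I_(size (gens l))) : dotv u (g j) = 0 -> aff k (g j).
    by move=> e0; apply/cone_aff/hu; split=> //; apply: cone_gen.
  exists (u + ee *: v); split=> [j|]; last split=> [x kx|].
  - rewrite dotvDl dotvZl; have := upos _ (cone_gen j); rewrite le_eqVlt => /orP[/eqP e0|p0].
      have ka := gk j (esym e0).
      by rewrite -e0 vk ?mulr0 ?addr0; [split | apply/affE].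
    have := hee ee; rewrite ee0 lexx => /(_ isT (dotv u (g j), dotv v (g j))).
    rewrite map_f ?mem_enum // => /(_ isT p0) /= h; split; first exact: ltW.
    by move=> h0; rewrite h0 ltxx in h.
  - by rewrite dotvDl dotvZl uk // vk ?mulr0 ?addr0 //; apply/affE.
  - by rewrite dotvDl dotvZl e add0r mulf_neq0 // gt_eqF.
(* The gap of two dimensions leaves a generator of [l] outside the span of [k] and [x0]. *)
have [j0 hj0] : exists j, ~~ (row j (cellmx l) <= cellmx k + x0)%MS.
  apply/row_subPn/negP => /mxrankS h.
  suff : (\rank (cellmx l) < \rank (cellmx l))%N by rewrite ltnn.
  apply: leq_ltn_trans h _.
  apply: leq_ltn_trans (mxrank_adds_leqif _ _) _; apply: leq_ltn_trans dkl.
  by rewrite -[(cdim k).+1]addn1 leq_add2l rank_leq_row.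
have [v [vk [vx0 vj0]]] : exists v : vec, (forall y : vec, aff k y -> dotv v y = 0) /\
    dotv v x0 = 0 /\ dotv v (g j0) < 0.
  have [v [h1 h2]] := separating_form hj0; rewrite rowK -/(g j0) in h2.
  have [hk hx] : (forall y : vec, aff k y -> dotv v y = 0) /\ dotv v x0 = 0.
    split=> [y /affE hy|]; apply: h1; first by apply: submx_trans hy (addsmxSl _ _).
    exact: addsmxSr.
  have [lt0|gt0|e0] := ltgtP (dotv v (g j0)) 0; last by rewrite e0 eqxx in h2.
    by exists v.
  exists (-1 *: v); rewrite !dotvZl hx mulr0 mulN1r oppr_lt0; split=> // y hy.
  by rewrite dotvZl hk // mulr0.
(* Ratio test: the least [q j] is the largest multiple of [v] that can be added to [u] while staying
   nonnegative on [l]. It is reached at a generator where [v] is negative, hence outside [aff k]. *)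
pose q (j : 'I_(size (gens l))) := dotv u (g j) / - dotv v (g j).
have [js vjs hq] : exists2 js : 'I_(size (gens l)), dotv v (g js) < 0 &
    forall j : 'I_(size (gens l)), dotv v (g j) < 0 -> q js <= q j.
  by case: (arg_minP (P := fun j => dotv v (g (val j)) < 0) q vj0) => js; exists js.
have q0 : 0 <= q js by rewrite divr_ge0 ?oppr_ge0 ?(ltW vjs) //; case: (u0 js).
have hu' j : dotv (u + q js *: v) (g j) = dotv u (g j) + q js * dotv v (g j).
  by rewrite dotvDl dotvZl.
have [l' hl'] : exists l' : idx, forall x, cone l' x <-> (cone l x /\ dotv (u + q js *: v) x = 0).
  apply: face_cell => j; rewrite hu'.
  have [ge0|lt0] := leP 0 (dotv v (g j)).
    by apply: addr_ge0; [case: (u0 j) | apply: mulr_ge0].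
  have : q js <= dotv u (g j) / - dotv v (g j) by apply: hq.
  by rewrite ler_pdivlMr ?oppr_gt0 // mulrN -subr_ge0 opprK.
have kl' : set_sub (cone k) (cone l').
  move=> x kx; apply/hl'; split; first exact: kl.
  by rewrite dotvDl dotvZl uk ?vk ?mulr0 ?addr0 //; apply: cone_aff.
have gl' : cone l' (g js).
  apply/hl'; split; first exact: cone_gen.
  by rewrite hu' /q invrN mulrN mulNr divfK ?subrr // lt_eqF.
exists l'; split=> //.
- by move=> x /hl'[].
- rewrite ltnNge; apply/negP => /(subcell_eq kl') e.
  have := vk (g js); rewrite e => /(_ (cone_aff gl')) e0.
  by rewrite e0 ltxx in vjs.
- move=> h; have := dotv_aff0 (k := l') (v := u + q js *: v) => /(_ _ x0 h).
  rewrite dotvDl dotvZl vx0 mulr0 addr0 => e.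
  by case/eqP: ux0; apply: e => x /hl'[].
Qed.

(** [enlarge_face] is iterated up to codimension one. The form of the resulting hyperplane later
    gives an element of [J k] outside a prime. *)
Lemma facet_avoiding (k s : idx) (x0 : vec) :
  set_sub (cone k) (cone s) -> cdim s = n.+1 -> ~ aff k x0 ->
  exists t : idx, [/\ set_sub (cone k) (cone t), set_sub (cone t) (cone s),
               cdim t = n & ~ aff t x0].
Proof.
move=> ks ds; have [m] := ubnP (n.+1 - cdim k); elim: m k ks => // m IH k ks hm nx.
have dk : (cdim k < n.+1)%N.
  rewrite ltnNge; apply/negP => h; apply: nx; apply/affE.
  by apply: submx_full; rewrite /row_full eqn_leq rank_leq_col; apply: h.
have [e|ne] := eqVneq (cdim k) n; first by exists k; split.
have [|l' [kl' l's dl' nl']] := enlarge_face ks nx.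
  by rewrite ds ltnS ltn_neqAle ne -ltnS.
have [||t [l't ts dt nt]] := IH l' _ _ nl' => //.
  by apply: leq_trans (_ : n.+1 - cdim k <= m)%N; rewrite // ltn_sub2l.
by exists t; split=> // x /kl' /l't.
Qed.

(** For [x0] in [s] outside [aff k], [enlarge_face] gives a proper face of [s] strictly larger than
    [k], so the upper cone shrinks until it is one dimension above [k]. *)
Lemma subcell_succ (k s : idx) :
  set_sub (cone k) (cone s) -> (cdim k < cdim s)%N ->
  exists l : idx, [/\ set_sub (cone k) (cone l), set_sub (cone l) (cone s) &
               cdim l = (cdim k).+1].
Proof.
move=> ks; have [m] := ubnP (cdim s); elim: m s ks => // m IH s ks hm ds.
have [e|ne] := eqVneq (cdim s) (cdim k).+1; first by exists s; split.
have [x0 sx0 nx0] : exists2 x0, cone s x0 & ~ aff k x0.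
  apply: NNPP => h; have : (cdim s <= cdim k)%N; last by rewrite leqNgt ds.
  apply: mxrankS; apply/row_subP => j; rewrite rowK; apply/affE; apply: NNPP => h'.
  by apply: h; exists (gens s)`_j => //; apply: cone_gen.
have [|l' [kl' l's dl' nl']] := enlarge_face ks nx0.
  by rewrite ltn_neqAle eq_sym ne.
have dl's : (cdim l' < cdim s)%N.
  rewrite ltnNge; apply/negP => /(subcell_eq l's) e.
  by apply: nl'; rewrite e; apply: cone_aff.
have [l [kl ll' dl]] := IH l' kl' (leq_trans dl's hm) dl'.
by exists l; split=> // x /ll' /l's.
Qed.

Lemma facet_above (k : idx) : exists s : idx, facet s /\ set_sub (cone k) (cone s).
Proof.
have [m] := ubnP (n.+1 - cdim k); elim: m k => // m IH k hm.
case: (classic (facet k)) => [fk|nf]; first by exists k; split.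
have [l [kl nlk]] : exists l : idx, set_sub (cone k) (cone l) /\ ~ set_sub (cone l) (cone k).
  by apply: NNPP => h; apply: nf => l kl; apply: NNPP => h'; apply: h; exists l.
have dl : (cdim k < cdim l)%N.
  by rewrite ltnNge; apply/negP => /(subcell_eq kl) e; apply: nlk; rewrite e.
have [|s [fs ls]] := IH l.
  apply: leq_trans (_ : n.+1 - cdim k <= m)%N => //; rewrite ltn_sub2l //.
  by apply: leq_trans dl (cdim_max l).
by exists s; split=> // x /kl /ls.
Qed.

Lemma dotvv_neq0 (u : vec) : u != 0 -> dotv u u != 0.
Proof.
apply: contraNneq; rewrite /dotv => /eqP; rewrite psumr_eq0 => [/allP h|j _]; last first.
  by rewrite -expr2 sqr_ge0.
apply/eqP/rowP => j; rewrite [RHS]mxE; apply/eqP.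
by have := h j (mem_index_enum j); rewrite mulf_eq0 orbb.
Qed.

(** Otherwise [aff t] and [x] would span the whole space and [u] would vanish at itself. *)
Lemma hyperplane_formE (t : idx) (u : vec) : cdim t = n -> u != 0 ->
  (forall x, aff t x -> dotv u x = 0) -> forall x, aff t x <-> dotv u x = 0.
Proof.
move=> dt /dotvv_neq0 uu ut x; split=> [/ut //|ux]; apply: NNPP => nx.
have full : (u <= cellmx t + x)%MS.
  apply: submx_full; rewrite /row_full eqn_leq rank_leq_col /= -{1}dt.
  rewrite ltnNge; apply/negP => h; apply: nx; apply/affE.
  have [_ e] := mxrank_leqif_sup (addsmxSl (cellmx t) x).
  apply: submx_trans (addsmxSr (cellmx t) x) _.
  by rewrite -e eqn_leq h mxrankS // addsmxSl.
case/sub_addsmxP: full => -[D1 D2] /= e.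
case/eqP: uu; rewrite {2}e dotvDr ut ?add0r; last by apply/affE/submxMl.
by rewrite (mx11_scalar D2) mul_scalar_mx dotvZr ux mulr0.
Qed.

Lemma hyperplane_form (t : idx) : cdim t = n ->
  exists2 u : vec, u != 0 & forall x, aff t x <-> dotv u x = 0.
Proof.
move=> dt; have [x0 nx0] : exists x0, ~ aff t x0.
  apply: NNPP => h; have : (n.+1 <= n)%N; last by rewrite ltnn.
  rewrite -{2}dt -{1}(mxrank1 R n.+1); apply: mxrankS; apply/row_subP => j; apply/affE.
  by apply: NNPP => h'; apply: h; exists (row j 1%:M).
have [|u [ut ux0]] := separating_form (A := cellmx t) (x := x0).
  by apply/negP => /affE.
have u0 : u != 0 by apply: contraNneq ux0 => ->; rewrite dotvE linear0 mulmx0 mxE.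
by exists u => //; apply: hyperplane_formE => // x /affE/ut.
Qed.

End Fan.
End Cones.

(** * The complex and its homology *)

Section SplineComplex.
Variables (R : realType) (n : nat).
Local Notation vec := 'rV[R]_(n.+1).
Local Notation S := {mpoly R[n.+1]}.
Variable F : seq (seq vec).
Local Notation idx := 'I_(size F).
Variables (alpha : idx -> int) (o : idx -> seq vec).
Hypotheses (fanF : is_fan F) (pureF : pure F).

Local Notation J := (Jid alpha (fun _ => True) (Sm1 alpha)).

Lemma Sm1_sub (k l : idx) : set_sub (cone k) (cone l) -> Sm1 alpha l -> Sm1 alpha k.
Proof. by move=> kl [t [dt [at1 lt]]]; exists t; do 2!split=> //; move=> x /kl /lt. Qed.

(** In [Jtau] each member chooses its own form. Forms vanishing on a hyperplane are proportional, so
    one fixed [u] serves for all, and sums stay in the ideal. *)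
Lemma JtauE (t : idx) (u : vec) (f : S) :
  u != 0 -> (forall x, aff t x <-> dotv u x = 0) ->
  Jtau alpha t f <-> exists g, f = g * linform u ^+ absz (alpha t + 1).
Proof.
move=> u0 hu; split=> [[v [g [v0 [hv ->]]]]|[g ->]]; last first.
  by exists u, g; do 2!split=> //; move=> x /hu.
have uu := dotvv_neq0 u0.
pose a := dotv v u / dotv u u.
suff -> : linform v = a%:MP * linform u.
  by exists (g * a%:MP ^+ absz (alpha t + 1)); rewrite exprMn mulrA.
apply: mpoly_ext => x; rewrite evM evC !ev_linform.
have : aff t (x + (- (dotv u x / dotv u u)) *: u).
  by apply/hu; rewrite dotvDr dotvZr mulNr divfK ?subrr.
move/hv; rewrite dotvDr dotvZr => /eqP; rewrite addr_eq0 => /eqP ->.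
by rewrite mulNr opprK /a mulrC mulrA mulrAC.
Qed.

Lemma Jtau_hyperplane (t : idx) : cdim t = n -> exists u : vec,
  [/\ u != 0, forall x, aff t x <-> dotv u x = 0 &
   forall f, Jtau alpha t f <-> exists g, f = g * linform u ^+ absz (alpha t + 1)].
Proof.
move=> dt; have [u u0 hu] := hyperplane_form dt.
by exists u; split=> // f; apply: JtauE.
Qed.

Lemma J0 k : J k 0.
Proof. by exists (fun _ => 0); split; [left | rewrite big1]. Qed.

Lemma J_gen (k t : idx) f : ~ Sm1 alpha t -> cdim t = n ->
  set_sub (cone k) (cone t) -> Jtau alpha t f -> J k f.
Proof.
move=> nt dt kt ht; exists (fun t' => if t' == t then f else 0); split=> [t'|].
  by case: eqP => [->|_]; [right | left].
by rewrite (bigD1 t) //= eqxx big1 ?addr0 // => t' /negbTE ->.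
Qed.

Lemma JD k f g : J k f -> J k g -> J k (f + g).
Proof.
case=> h [hh ->] [h' [hh' ->]]; exists (fun t => h t + h' t); split; last by rewrite big_split.
move=> t; case: (hh t) => [->|[_ [nt [dt [kt ht]]]]]; first by rewrite add0r.
case: (hh' t) => [->|[_ [_ [_ [_ ht']]]]].
  by rewrite addr0; right.
right; do 4!split=> //; have [u [_ _ hu]] := Jtau_hyperplane dt.
case/hu: ht => a ->; case/hu: ht' => b ->; apply/hu; exists (a + b).
by rewrite mulrDl.
Qed.

Lemma JM k f g : J k g -> J k (f * g).
Proof.
case=> h [hh ->]; exists (fun t => f * h t); split; last by rewrite mulr_sumr.
move=> t; case: (hh t) => [->|[_ [nt [dt [kt [u [b [u0 [hu ->]]]]]]]]].
  by left; rewrite mulr0.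
by right; do 4!split=> //; exists u, (f * b); do 2!split=> //; rewrite mulrA.
Qed.

Lemma JN k f : J k f -> J k (- f).
Proof. by rewrite -mulN1r; apply: JM. Qed.

(** The forms of [n]-faces containing [k] vanish on [aff k], so translation along it fixes the
    generators of [J k]. *)
Lemma J_transl k w f : aff k w -> J k f -> J k (transl w f).
Proof.
move=> kw [h [hh ->]]; exists (fun t => transl w (h t)); split; last by rewrite rmorph_sum.
move=> t; case: (hh t) => [->|[_ [nt [dt [kt [u [b [u0 [hu ->]]]]]]]]].
  by left; rewrite rmorph0.
right; do 4!split=> //; exists u, (transl w b); do 2!split=> //.
by rewrite rmorphM rmorphXn /= transl_linform //; apply/hu/(aff_sub kt).
Qed.

Lemma incid_sub (l k : idx) : incid o l k != 0 -> codim1 l k.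
Proof. by rewrite /incid; case: pdecP => // _; rewrite eqxx. Qed.

Lemma incid_sq (l k : idx) : codim1 l k -> incid o l k * incid o l k = 1.
Proof. by move=> c; rewrite /incid; case: pdecP => // _; case: ifP. Qed.

Lemma codim1E (l k : idx) : set_sub (cone k) (cone l) -> cdim l = (cdim k).+1 -> codim1 l k.
Proof. by move=> kl e; split=> //; rewrite e. Qed.

(** The boundary at [k] sees only cells containing [k]; this compares the whole complex with its
    localizations. *)
Lemma dmap_restrict (D D' : idx -> Prop) (c c' : idx -> S) k :
  (forall l, D' l -> D l) ->
  (forall l, D l -> set_sub (cone k) (cone l) -> D' l) ->
  (forall l, D' l -> set_sub (cone k) (cone l) -> c l = c' l) -> dmap o D c k = dmap o D' c' k.
Proof.
move=> sub up e; rewrite /dmap.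
rewrite (bigID (fun l => pdec (D' l))) /= [X in _ + X]big1 ?addr0; last first.
  move=> l /andP[/pdecP Dl /pdecP nD'].
  have [->|/incid_sub [kl _]] := eqVneq (incid o l k) 0; first by rewrite mul0r.
  by case: nD'; apply: up.
apply: eq_big => [l|l /andP[_ /pdecP /e h]]; last first.
  have [->|/incid_sub [kl _]] := eqVneq (incid o l k) 0; first by rewrite !mul0r.
  by rewrite h.
by apply/andP/pdecP => [[_ /pdecP] //|h]; split; apply/pdecP => //; apply: sub.
Qed.

Lemma dmapM D f c k : dmap o D (fun l => f * c l) k = f * dmap o D c k.
Proof. by rewrite /dmap mulr_sumr; apply: eq_bigr => l _; rewrite mulrCA. Qed.

Lemma dmapD D c c' k :
  dmap o D (fun l => c l + c' l) k = dmap o D c k + dmap o D c' k.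
Proof. by rewrite /dmap -big_split; apply: eq_bigr => l _; rewrite mulrDr. Qed.

Lemma dmapB D c c' k :
  dmap o D (fun l => c l - c' l) k = dmap o D c k - dmap o D c' k.
Proof. by rewrite /dmap -sumrB; apply: eq_bigr => l _; rewrite mulrBr. Qed.

Lemma dmap_transl D w c k :
  dmap o D (fun l => transl w (c l)) k = transl w (dmap o D c k).
Proof.
by rewrite /dmap rmorph_sum; apply: eq_bigr => l _; rewrite rmorphM rmorph_int.
Qed.

(** * Annihilators and vanishing of homology classes *)

Section Homology.
Variable D : idx -> Prop.
Variable i : nat.
Local Notation B := (hbound o D J i).

Lemma hbound_ext (A : idx -> S -> Prop) (c c' : idx -> S) :
  (forall k, D k -> c k = c' k) -> hbound o D A i c -> hbound o D A i c'.
Proof. by move=> e [b [hb h]]; exists b; split=> // k Dk dk; rewrite -e //; apply: h. Qed.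

Lemma hbound_add (A : idx -> S -> Prop) (AD : forall k f g, A k f -> A k g -> A k (f + g)) c c' :
  hbound o D A i c -> hbound o D A i c' -> hbound o D A i (fun k => c k + c' k).
Proof.
move=> [b [hb h]] [b' [hb' h']]; exists (fun k => b k + b' k); split=> [k|k Dk dk].
  have [->|/eqP/hb //] := eqVneq (b k) 0.
  by rewrite add0r => /hb'.
by rewrite dmapD opprD addrACA; apply: AD; [apply: h | apply: h'].
Qed.

Lemma hboundM f c : B c -> B (fun k => f * c k).
Proof.
move=> [b [hb h]]; exists (fun k => f * b k); split=> [k hk|k Dk dk].
  by apply: hb => e; apply: hk; rewrite e mulr0.
by rewrite dmapM -mulrBr; apply/JM/h.
Qed.

Lemma hbound_transl w c : (forall k, D k -> aff k w) -> B c -> B (fun k => transl w (c k)).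
Proof.
move=> hw [b [hb h]]; exists (fun k => transl w (b k)); split=> [k hk|k Dk dk].
  by apply: hb => e; apply: hk; rewrite e rmorph0.
by rewrite dmap_transl -rmorphB; apply: J_transl; [apply: hw | apply: h].
Qed.

(** Boundaries are stable under translation along the row space, so by [idealW_torsion_free] a
    member of [P] outside the ideal would make [c] a boundary and put 1 into [P]. *)
Lemma ann_idealW (P : S -> Prop) m (A : 'M[R]_(m, n.+1)) (c : idx -> S) :
  (forall k x, D k -> (x <= A)%MS -> aff k x) -> ~ P 1 ->
  (forall f, P f <-> B (fun k => f * c k)) ->
  (forall f, idealW (rowsp A) f -> P f) -> forall f, P f -> idealW (rowsp A) f.
Proof.
move=> hA nP1 hP IP f Pf; apply: NNPP => nf; apply: nP1; apply/hP.
have [N hN] : exists N, forall k, nilord N (c k).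
  have /fin_all_exists[N hN] k := nilord_exists (c k).
  by exists (\max_k N k) => k; apply: nilord_le (hN k); apply: leq_bigmax.
have : B c; last by apply: hbound_ext => k _; rewrite mul1r.
apply: (@idealW_torsion_free _ _ _ A _ B _ (hbound_add JD) hboundM _ N c f) => //.
- by move=> c1 c2 e; apply: hbound_ext => k _; apply: e.
- by move=> w c1 hw; apply: hbound_transl => k Dk; apply: hA hw.
- by move=> g /IP/hP.
- by apply/hP.
Qed.

Hypothesis Dup : forall k l, D k -> set_sub (cone k) (cone l) -> D l.
Variables (m : nat) (A : 'M[R]_(m, n.+1)).
Hypothesis DA : forall k, D k -> (A <= cellmx k)%MS.

(** Both cells have the row space of [A] as span, and a face of [l] is determined by its span. *)
Lemma cell_determined (k k' l : idx) : D k -> D k' ->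
  cdim k = \rank A -> cdim k' = \rank A ->
  set_sub (cone k) (cone l) -> set_sub (cone k') (cone l) -> k = k'.
Proof.
move=> Dk Dk' dk dk' kl k'l.
have eqA k1 : D k1 -> cdim k1 = \rank A -> forall x, aff k1 x <-> (x <= A)%MS.
  move=> Dk1 d1 x; have [_ e] := mxrank_leqif_sup (DA Dk1).
  have sA : (cellmx k1 <= A)%MS by rewrite -e -d1.
  by rewrite affE; split=> h; apply: submx_trans h _ => //; apply: DA.
apply: cell_eq => // x kx.
  apply: (subcell_aff fanF k'l); first exact: kl.
  by apply/(eqA k')/(eqA k)/cone_aff.
apply: (subcell_aff fanF kl); first exact: k'l.
by apply/(eqA k)/(eqA k')/cone_aff.
Qed.

(* The cells of minimal dimension [\rank A] are free faces: a cell one dimension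
   higher contains at most one of them, so any chain on them is hit. *)
Lemma dmap_surjective (X : idx -> idx -> S) (delta : idx -> idx -> idx) :
  (forall k t, D k -> cdim k = \rank A -> X k t <> 0 ->
     set_sub (cone k) (cone (delta k t)) /\ cdim (delta k t) = (\rank A).+1) ->
  exists b, [/\ is_chain D (\rank A).+1 b,
    forall k, D k -> cdim k = \rank A -> dmap o D b k = \sum_t X k t &
    forall l, (forall k t, D k -> cdim k = \rank A -> X k t <> 0 -> delta k t = l ->
                 J l (X k t)) -> J l (b l)].
Proof.
move=> hd.
pose C l k t := D k /\ cdim k = \rank A /\ X k t <> 0 /\ delta k t = l.
(* [X k t] is put on the cell [delta k t] with its incidence sign, which the boundary map squares to
   1. The index [t] lets one value at [k] be spread over several cofaces. *)
pose b l : S := \sum_k \sum_t if pdec (C l k t) then (incid o l k)%:~R * X k t else 0.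
have bP (Q : S -> Prop) l : Q 0 -> (forall f g, Q f -> Q g -> Q (f + g)) ->
    (forall f g, Q g -> Q (f * g)) -> (forall k t, C l k t -> Q (X k t)) -> Q (b l).
  move=> Q0 QD QM QX; rewrite /b; apply: big_ind => // k _; apply: big_ind => // t _.
  by case: pdecP => // /QX h; apply: QM.
exists b; split=> [l bl|k' Dk' dk'|l hl]; last first.
- by apply: bP; [apply: J0 | apply: JD | apply: JM | move=> k t [h1 [h2 [h3 h4]]]; apply: hl].
- have E l : (incid o l k')%:~R * b l =
      \sum_t if pdec (X k' t <> 0 /\ delta k' t = l) then X k' t else 0.
    have [e0|nz] := eqVneq (incid o l k') 0.
      rewrite e0 mul0r big1 // => t _; case: pdecP => // -[x0 dl].
      have [kd dd] := hd _ _ Dk' dk' x0; rewrite -dk' dl in kd dd.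
      by have := incid_sq (codim1E kd dd); rewrite e0 mul0r.
    have [k'l _] := incid_sub nz.
    rewrite /b (bigD1 k') //= [X in _ * (_ + X)]big1 ?addr0; last first.
      move=> k /eqP nk; rewrite big1 // => t _; case: pdecP => // -[Dk [dk [x0 dl]]].
      have [kd _] := hd _ _ Dk dk x0; rewrite dl in kd.
      by case: nk; apply: cell_determined kd k'l.
    rewrite mulr_sumr; apply: eq_bigr => t _.
    case: pdecP => [[_ [_ [x0 dl]]]|h]; case: pdecP => [h'|h'].
    + by rewrite mulrA -intrM incid_sq ?mul1r //; apply: incid_sub.
    + by case: h'.
    + by case: h; case: h'.
    + by rewrite mulr0.
  rewrite /dmap (eq_bigr _ (fun l _ => E l)) exchange_big /=; apply: eq_bigr => t _.
  have [x0|/eqP x0] := eqVneq (X k' t) 0; first by rewrite big1 // => l _; case: ifP.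
  have [kd dd] := hd _ _ Dk' dk' x0.
  rewrite (bigD1 (delta k' t)) /=; last by apply/pdecP; apply: Dup kd.
  case: pdecP => [_|[] //]; rewrite big1 ?addr0 // => l /andP[_ nl].
  by case: pdecP => // -[_ e]; rewrite e eqxx in nl.
- apply: NNPP => h; apply: bl; apply: (bP (fun f => f = 0)) => //.
  + by move=> f g -> ->; rewrite addr0.
  + by move=> f g ->; rewrite mulr0.
  + move=> k t [Dk [dk [x0 dl]]]; have [kd dd] := hd _ _ Dk dk x0.
    by case: h; rewrite -dl; split=> //; apply: Dup kd.
Qed.

Lemma hbound_high (c : idx -> S) : (i <= n)%N -> (i <= \rank A)%N ->
  is_chain D i c -> B c.
Proof.
move=> lin; rewrite leq_eqVlt => /orP[/eqP ei|lt_i] hc; last first.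
  have c0 k : c k = 0.
    apply: NNPP => /hc [Dk dk]; have := mxrankS (DA Dk).
    by rewrite -cdimE dk leqNgt lt_i.
  exists (fun _ => 0); split=> // k Dk dk; rewrite c0 sub0r; apply: JN.
  by rewrite /dmap big1 => [|l _]; [apply: J0 | rewrite mulr0].
(* As [i <= n], a cell of dimension [i] lies strictly inside a facet and so has a coface. *)
have /fin_all_exists[delta hdelta] (k : idx) : exists l : idx, cdim k = i ->
    set_sub (cone k) (cone l) /\ cdim l = i.+1.
  have [e|/eqP ne] := eqVneq (cdim k) i; last by exists k.
  have [s [fs ks]] := facet_above fanF k.
  have [|l [kl _ dl]] := subcell_succ fanF ks; first by rewrite e pureF.
  by exists l => _; rewrite dl e.
pose X k t := if t == k then c k else 0.
have [|b [hb db Jb]] := dmap_surjective (X := X) (delta := fun k _ => delta k).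
  by move=> k t Dk dk _; rewrite -ei; apply: hdelta; rewrite ei.
rewrite -ei in hb db; exists b; split=> // k Dk dk.
rewrite db // (bigD1 k) //= /X eqxx big1 ?addr0 ?subrr; last by move=> t /negbTE ->.
exact: J0.
Qed.

(** The boundary of [c] at [k] is a sum of terms from ideals [Jtau alpha t]. Each term is moved to
    an [i]-face between [k] and [t]; this face still lies in [t], so its ideal contains the term. *)
Lemma hbound_corner (c : idx -> S) : (i <= n)%N -> i = (\rank A).+1 ->
  hcycle o D J i c -> H_zero o D (fun _ f => f = 0) i -> B c.
Proof.
move=> lin ei [hc cyc] H0.
have /fin_all_exists[h hh] (k : idx) : exists h : idx -> S, D k -> cdim k = \rank A ->
   (forall t, h t = 0 \/ (True /\ ~ Sm1 alpha t /\ cdim t = n /\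
                   set_sub (cone k) (cone t) /\ Jtau alpha t (h t))) /\
   dmap o D c k = \sum_t h t.
  case: (classic (D k /\ cdim k = \rank A)) => [[Dk dk]|nk].
    by have [|h] := cyc k Dk _; [rewrite dk ei | exists h].
  by exists (fun _ => 0) => Dk dk; case: nk.
have /fin_all_exists[delta hdelta] (k : idx) : exists d : idx -> idx, forall t,
    D k -> cdim k = \rank A -> h k t <> 0 ->
    [/\ set_sub (cone k) (cone (d t)), set_sub (cone (d t)) (cone t) & cdim (d t) = i].
  have /fin_all_exists[d hd] (t : idx) : exists l : idx, D k -> cdim k = \rank A -> h k t <> 0 ->
    [/\ set_sub (cone k) (cone l), set_sub (cone l) (cone t) & cdim l = i].
    case: (classic (D k /\ cdim k = \rank A /\ h k t <> 0)) => [[Dk [dk h0]]|nk]; last first.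
      by exists k => *; case: nk.
    have [ht _] := hh k Dk dk; case: (ht t) => // -[_ [nt [dt [kt _]]]].
    have [|l [kl lt dl]] := subcell_succ fanF kt; first by rewrite dk dt -ltnS -ei.
    by exists l => _ _ _; rewrite dl dk ei.
  by exists d.
have [|b [hb db Jb]] := dmap_surjective (X := h) (delta := delta).
  by move=> k t Dk dk h0; have [? ? e] := hdelta k t Dk dk h0; rewrite e ei.
have Jb' l : J l (b l).
  apply: Jb => k t Dk dk h0 <-; have [ht _] := hh k Dk dk.
  have [_ dt' _] := hdelta k t Dk dk h0.
  by case: (ht t) => // -[_ [nt [dt [kt Jt]]]]; apply: (J_gen nt dt dt').
(* [b] has values in [J] and the same boundary as [c], so [c - b] is a cycle with constant
   coefficients; a chain bounding it bounds [c] modulo [J]. *)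
have [|b' [hb' db']] := H0 (fun k => c k - b k).
  split=> [k|k Dk dk].
    have [->|/eqP/hc //] := eqVneq (c k) 0.
    by rewrite ei sub0r => nb; apply: hb => e; apply: nb; rewrite e oppr0.
  have dk' : cdim k = \rank A by move: dk; rewrite ei => -[].
  by rewrite dmapB db // (proj2 (hh k Dk dk')) subrr.
exists b'; split=> // k Dk dk; have /eqP := db' k Dk dk.
by rewrite subr_eq0 => /eqP <-; rewrite opprB addrC subrK.
Qed.

End Homology.
End SplineComplex.

(** * Localization *)

Lemma chain_trans (R : realType) n (F : seq (seq 'rV[R]_n.+1))
    (Q : 'I_(size F) -> Prop) E s s' s'' :
  chain Q E s s' -> chain Q E s' s'' -> chain Q E s s''.
Proof.
case=> m [f [f0 [fm [hQ hE]]]] [m' [f' [f'0 [f'm [hQ' hE']]]]].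
exists (m + m')%N, (fun j => if (j <= m)%N then f j else f' (j - m)%N).
split; first by rewrite leq0n.
split.
  case: leqP => [h|_]; last by rewrite addKn.
  have e : m' = 0%N by apply/eqP; rewrite -leqn0 -(leq_add2l m) addn0.
  by rewrite e addn0 fm -f'm e f'0.
split=> j hj.
  case: leqP => h; first exact: hQ.
  by apply: hQ'; rewrite leq_subLR.
case: (ltngtP j m) => h.
- by apply: hE.
- rewrite subSn ?(ltnW h) //; apply: hE'.
  by rewrite ltn_subLR // ltnW.
- rewrite h subSnn fm -f'0; apply: hE'.
  by rewrite h -[X in (X < _)%N]addn0 ltn_add2l in hj.
Qed.

Section Localization.
Variables (R : realType) (n : nat).
Local Notation vec := 'rV[R]_(n.+1).
Local Notation S := {mpoly R[n.+1]}.
Variable F : seq (seq vec).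
Local Notation idx := 'I_(size F).
Variables (alpha : idx -> int) (o : idx -> seq vec).
Hypotheses (fanF : is_fan F) (pureF : pure F) (heredF : hereditary F).

Local Notation J := (Jid alpha (fun _ => True) (Sm1 alpha)).
Local Notation nSm1 := (fun k => ~ Sm1 alpha k).

(** The cells of the relative complex of the pair [SigmaW], [Sm1W], in the form used by
    [H_R_WS_zero]. *)
Definition Dclass (W : vec -> Prop) (s k : idx) : Prop :=
  SigmaW W s k /\ ~ Sm1W alpha W s k.

Lemma DclassE W s k :
  Dclass W s k <-> [/\ SigmaW W s k, set_sub W (aff k) & ~ Sm1 alpha k].
Proof.
split=> [[h1 h2]|[h1 h2 h3]]; last by split=> // -[[]].
split=> //; last by move=> h; apply: h2; split=> //; right.
by apply: NNPP => h; apply: h2; split=> //; left.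
Qed.

(* By heredity, the star of a cell spanning [W] lies in one class. *)
Lemma SigmaW_up W (s k l : idx) : set_sub W (aff k) ->
  set_sub (cone k) (cone l) -> SigmaW W s k -> SigmaW W s l.
Proof.
move=> Wk kl [s' [ch ks']]; have [s'' [fs'' ls'']] := facet_above fanF l.
exists s''; split=> //; apply: (chain_trans ch).
have fs' : facet s' by case: ch => m [f [_ [<- [h _]]]]; apply: h.
have [|m [f [f0 [fm [hQ hE]]]]] := heredF fs' ks' fs''; first by move=> x /kl /ls''.
exists m, f; do 2!split=> //; split=> j hj; first by case: (hQ j hj).
have [t [dt ht]] := hE j hj; exists t; do 2!split=> //.
move=> x /Wk; apply: aff_sub => y ky; apply/ht.
by split; [case: (hQ j (ltnW hj)) | case: (hQ j.+1 hj)] => _; apply.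
Qed.

Lemma Dclass_up W s k l : Dclass W s k -> set_sub (cone k) (cone l) -> Dclass W s l.
Proof.
move=> /DclassE[h1 h2 h3] kl; apply/DclassE; split.
- exact: SigmaW_up h1.
- by move=> x /h2; apply: aff_sub.
- by move=> h; apply: h3; apply: Sm1_sub h.
Qed.

Lemma Dclass_down W s k l : set_sub W (aff k) -> ~ Sm1 alpha k ->
  set_sub (cone k) (cone l) -> Dclass W s l -> Dclass W s k.
Proof.
move=> Wk nk kl /DclassE[[s' [ch ls']] _ _]; apply/DclassE; split=> //.
by exists s'; split=> // x /kl /ls'.
Qed.

Lemma SigmaW_facet W (s k : idx) : facet s -> set_sub (cone k) (cone s) -> SigmaW W s k.
Proof.
move=> fs ks; exists s; split=> //.
by exists 0%N, (fun=> s); do 2!split=> //; split=> // j; rewrite ltn0.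
Qed.

Lemma Dclass_facet W s k : facet s -> set_sub (cone k) (cone s) ->
  set_sub W (aff k) -> ~ Sm1 alpha k -> Dclass W s k.
Proof.
by move=> fs ks Wk nk; apply/DclassE; split=> //; apply: SigmaW_facet.
Qed.

(** * The flat of a prime and the splitting into classes *)

Section Prime.
Variable P : S -> Prop.
Hypothesis primeP : prime_ideal P.

Definition Pwall (t : idx) : Prop :=
  [/\ cdim t = n, ~ Sm1 alpha t &
   exists u : vec, [/\ u != 0, forall x, aff t x -> dotv u x = 0 & P (linform u)]].

(** The candidate for the zero set of [P]; it is the whole space when no [Pwall] exists. *)
Definition Pflat (x : vec) : Prop := forall t, Pwall t -> aff t x.

Lemma inL_Pflat : inL alpha Pflat.
Proof. by exists Pwall; split=> // t [? ? _]. Qed.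

Lemma Pflat_mx : exists A : 'M[R]_n.+1, forall x, Pflat x <-> (x <= A)%MS.
Proof.
exists (\bigcap_(t | pdec (Pwall t)) <<cellmx t>>)%MS => x; split=> [h|/sub_bigcapmxP h t ht].
  by apply/sub_bigcapmxP => t /pdecP /h; rewrite genmxE => /affE.
by have := h t; rewrite genmxE => h'; apply/affE/h'/pdecP.
Qed.

Lemma prime_exp (f : S) e : P (f ^+ e) -> P f.
Proof.
case: primeP => _ [_ [_ [n1 hM]]]; elim: e => [|e IH]; first by rewrite expr0 => /n1.
by rewrite exprS => /hM[].
Qed.

Lemma prime_prodN (I : finType) (f : I -> S) : (forall k, ~ P (f k)) -> ~ P (\prod_k f k).
Proof.
case: primeP => _ [_ [_ [n1 hM]]] hf; apply: (big_ind (fun g => ~ P g)) => // a b na nb.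
by case/hM.
Qed.

Lemma idealW_Pflat f : idealW Pflat f -> P f.
Proof.
case: primeP => P0 [PD [PM _]] hf; have [A hA] := Pflat_mx.
(* Cells that are not walls receive the zero form, which imposes no condition. *)
have /fin_all_exists[U hU] (t : idx) : exists u : vec, P (linform u) /\
    (Pwall t -> forall x, dotv u x = 0 -> aff t x).
  case: (classic (Pwall t)) => [[dt nt [u [u0 ut Pu]]]|nt].
    by exists u; split=> // _ x ux; apply/(hyperplane_formE dt u0 ut).
  exists 0; split=> //; suff -> : linform 0 = 0 :> S by [].
  by apply: mpoly_ext => x; rewrite ev_linform ev0 dotvE linear0 mulmx0 mxE.
apply: (@idealW_sub_ideal _ _ _ A P _ U) => //.
- by move=> t; case: (hU t).
- by move=> x hx; apply/hA => t ht; case: (hU t) => _ /(_ ht); apply.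
- by move=> x /hA; apply: hf.
Qed.

(** An [n]-face through [k] missing a point of the flat is no [Pwall]; the generator of its ideal is
    a power of a form outside [P]. *)
Lemma bad_cell k : ~ Sm1 alpha k -> ~ set_sub Pflat (aff k) -> exists2 q, ~ P q & J k q.
Proof.
move=> nk nW; have [x Wx nx] : exists2 x, Pflat x & ~ aff k x.
  by apply: NNPP => h; apply: nW => x Wx; apply: NNPP => nx; apply: h; exists x.
have [s [fs ks]] := facet_above fanF k.
have [t [kt ts dt nt]] := facet_avoiding fanF ks (pureF fs) nx.
have nSt : ~ Sm1 alpha t by move=> h; apply: nk; apply: Sm1_sub h.
have [u [u0 hu hJ]] := Jtau_hyperplane alpha dt.
exists (linform u ^+ absz (alpha t + 1)).
  move=> /prime_exp Pu; apply: nt; apply: Wx; split=> //.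
  by exists u; split=> // y /hu.
by apply: (J_gen nSt dt kt); apply/hJ; exists 1; rewrite mul1r.
Qed.

Definition restr (D : idx -> Prop) (c : idx -> S) k := if pdec (D k) then c k else 0.

Lemma restrE D c k : D k -> restr D c k = c k.
Proof. by move=> h; rewrite /restr; case: pdecP. Qed.

Lemma is_chain_restr (D D' : idx -> Prop) i c :
  is_chain D i c -> is_chain D' i (restr D' c).
Proof. by move=> h k; rewrite /restr; case: pdecP => // Dk /h[]. Qed.

(** A class is closed under passing to larger cells, so restriction to it commutes with the
    boundary. *)
Lemma dmap_class W s c k : Dclass W s k ->
  dmap o nSm1 c k = dmap o (Dclass W s) (restr (Dclass W s) c) k.
Proof.
move=> Dk; apply: dmap_restrict => [l /DclassE[] //|l nl kl|l Dl _].
  exact: Dclass_up kl.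
by rewrite restrE.
Qed.

(* Outside the classes [Dclass Pflat s] the complex is killed by elements not in [P]. *)
Lemma ann_component i c : hcycle o nSm1 J i c ->
  (forall f, P f <-> hbound o nSm1 J i (fun k => f * c k)) ->
  exists (s : idx) (c' : idx -> S), [/\ facet s, hcycle o (Dclass Pflat s) J i c' &
    forall f, P f <-> hbound o (Dclass Pflat s) J i (fun k => f * c' k)].
Proof.
case: primeP => P0 [PD [PM [nP1 PP]]] [hc cyc] hP; set W := Pflat.
pose cs s := restr (Dclass W s) c.
have cs_cycle s : hcycle o (Dclass W s) J i (cs s).
  split; first exact: is_chain_restr hc.
  by move=> k Dk dk; rewrite -dmap_class //; apply: cyc => //; case/DclassE: Dk.
have Pcs s f : P f -> hbound o (Dclass W s) J i (fun k => f * cs s k).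
  move/hP => [b [hb hk]]; exists (restr (Dclass W s) b); split; first exact: is_chain_restr hb.
  move=> k Dk dk; rewrite -dmap_class // /cs restrE //; apply: hk => //; by case/DclassE: Dk.
apply: NNPP => no.
(* If no component had annihilator [P], each would be killed by some [fb.1] outside [P], with
   bounding chain [fb.2]; non-facets get the multiplier 1. *)
have /fin_all_exists[fb hfb] (s : idx) : exists fb : S * (idx -> S), ~ P fb.1 /\
   (facet s -> is_chain (Dclass W s) i.+1 fb.2 /\ forall k, Dclass W s k -> cdim k = i ->
      J k (fb.1 * c k - dmap o (Dclass W s) fb.2 k)).
  case: (classic (facet s)) => [fs|nf]; last by exists (1, fun=> 0).
  have [f [nPf [b [hb hk]]]] : exists f, ~ P f /\ hbound o (Dclass W s) J i (fun k => f * cs s k).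
    apply: NNPP => h; apply: no; exists s, (cs s); split=> // f; split; first exact: Pcs.
    by move=> hf; apply: NNPP => nPf; apply: h; exists f.
  exists (f, b); split=> // _; split=> // k Dk dk.
  by have := hk k Dk dk; rewrite /cs restrE.
have /fin_all_exists[q hq] (k : idx) : exists q, ~ P q /\
   (~ Sm1 alpha k -> ~ set_sub W (aff k) -> J k q).
  case: (classic (~ Sm1 alpha k /\ ~ set_sub W (aff k))) => [[nk nW]|h].
    by have [q nq Jq] := bad_cell nk nW; exists q.
  by exists 1; split=> // nk nW; case: h.
pose f := \prod_s (fb s).1; pose Q := \prod_k q k.
have nPf : ~ P f by apply: prime_prodN => s; case: (hfb s).
have nPQ : ~ P Q by apply: prime_prodN => s; case: (hq s).
suff : P (Q * f) by case/PP.
(* Several facets may define the same class, so one representative is picked for each cell. The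
   bounding chains are then glued, each scaled by the multipliers of all other facets to reach the
   common factor [f]. *)
pose cl l := [pick s | pdec (facet s /\ Dclass W s l)].
pose b l := if cl l is Some s then (\prod_(s' | s' != s) (fb s').1) * (fb s).2 l else 0.
apply/hP; exists (fun l => Q * b l); split=> [l|k nk dk].
  rewrite /b /cl; case: pickP => [s /pdecP [fs Dl] nz|_]; last by rewrite mulr0.
  case: (hfb s) => _ /(_ fs) [hb _].
  have [] := hb l; first by move=> e; apply: nz; rewrite e !mulr0.
  by case/DclassE.
rewrite dmapM -mulrA -mulrBr.
case: (classic (set_sub W (aff k))) => [Wk|nW]; last first.
  rewrite mulrC; apply: JM; rewrite /Q (bigD1 k) //= mulrC; apply: JM.
  by case: (hq k) => _; apply.
apply: JM.
have [s [fs Dk cs_k]] : exists s, [/\ facet s, Dclass W s k & cl k = Some s].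
  rewrite /cl; case: pickP => [s /pdecP [fs Dk]|h]; first by exists s.
  have [s [fs ks]] := facet_above fanF k.
  by have /pdecP[] := h s; split=> //; apply: Dclass_facet.
(* [k] and its cofaces outside [Sm1 alpha] belong to the same classes, so the same representative is
   picked and the glued chain is [fb s] around [k]. *)
have cl_up l : ~ Sm1 alpha l -> set_sub (cone k) (cone l) -> cl l = Some s.
  move=> nl kl; rewrite -cs_k; apply: eq_pick => s'.
  apply/pdecP/pdecP => -[fs' D']; split=> //; [exact: Dclass_down D'|exact: Dclass_up kl].
have -> : dmap o nSm1 b k = (\prod_(s' | s' != s) (fb s').1) * dmap o (Dclass W s) (fb s).2 k.
  rewrite -dmapM; apply: dmap_restrict => [l /DclassE[] //|l nl kl|l Dl kl].
    exact: Dclass_up kl.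
  by rewrite /b cl_up //; case/DclassE: Dl.
rewrite /f (bigD1 s) //= [_ * \prod_(_ | _) _]mulrC -mulrA -mulrBr; apply: JM.
by case: (hfb s) => _ /(_ fs) [_]; apply.
Qed.

End Prime.
End Localization.

(** * Orientations *)

Section Orientation.
Variables (R : realType) (n : nat).
Local Notation vec := 'rV[R]_(n.+1).
Variable F : seq (seq vec).
Local Notation idx := 'I_(size F).
Variable o : idx -> seq vec.
Hypotheses (fanF : is_fan F) (oriF : orientation o).

(** The dimension is a parameter so that the block matrices below, of sizes [1 + d] and
    [1 + (1 + d)], need no casts. *)
Definition orimx (d : nat) (k : idx) : 'M[R]_(d, n.+1) := \matrix_(j < d) (o k)`_j.

Lemma size_orientation k : size (o k) = cdim k.
Proof.
apply/(dimW_rank (W := aff k) (A := cellmx k)) => [x|]; first exact: affE.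
by exists (o k).
Qed.

Lemma orimx_aff d k x : cdim k = d -> aff k x <-> (x <= orimx d k)%MS.
Proof.
by move=> <-; rewrite /orimx -size_orientation; have [_ h] := oriF k; rewrite h in_spanE.
Qed.

Lemma orimx_free d k : cdim k = d -> row_free (orimx d k).
Proof.
by move=> <-; rewrite /orimx -size_orientation; have [h _] := oriF k; apply/lin_indepE.
Qed.

Lemma same_orientE d (v : vec) (k l : idx) : cdim k = d -> cdim l = d.+1 ->
  same_orient (v :: o k) (o l) <->
  exists2 T : 'M[R]_(1 + d), 0 < \det T & col_mx v (orimx d k) = T *m orimx (1 + d) l.
Proof.
move=> dk dl.
have rowv (j : 'I_(1 + d)) : (v :: o k)`_j = row j (col_mx v (orimx d k)).
  case: (split_ordP j) => j' ->.
    by rewrite (ord1 j') rowKu; apply/rowP => a; rewrite mxE.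
  by rewrite rowKd rowK.
split=> [[m [T [sA [sB [T0 hT]]]]]|[T T0 hT]].
  have em : m = (1 + d)%N by rewrite -sB size_orientation.
  move: em T sA sB T0 hT => -> T _ _ T0 hT; exists T => //.
  apply/row_matrixP => j; rewrite -rowv hT row_mul mulmx_sum_row.
  by apply: eq_bigr => a _; rewrite rowK mxE.
exists (1 + d)%N, T; rewrite /= !size_orientation dk dl; do 3!split=> //.
move=> j; rewrite rowv hT row_mul mulmx_sum_row.
by apply: eq_bigr => a _; rewrite rowK mxE.
Qed.

(* The sign of the orientation does not depend on the chosen vector, because
   all of [cone l] lies on one side of [aff k]. *)
Lemma incid_det d (k l : idx) (v : vec) : set_sub (cone k) (cone l) ->
  cdim k = d -> cdim l = d.+1 -> cone l v -> ~ aff k v ->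
  exists2 T : 'M[R]_(1 + d), 0 < (incid o l k)%:~R * \det T &
    col_mx v (orimx d k) = T *m orimx (1 + d) l.
Proof.
move=> kl dk dl lv nkv.
have frk := orimx_free dk; have frl := @orimx_free (1 + d) l dl.
have colv_sub w : cone l w -> (col_mx w (orimx d k) <= orimx (1 + d) l)%MS.
  move=> lw; rewrite col_mx_sub; apply/andP; split; first exact/(orimx_aff _ dl)/cone_aff.
  by apply/rV_subP => x /(orimx_aff x dk) kx; apply/(orimx_aff _ dl); apply: aff_sub kx.
have colv_free w : ~ aff k w -> row_free (col_mx w (orimx d k)).
  move=> nw; rewrite /row_free eqn_leq rank_leq_row /= -addsmxE.
  rewrite ltnNge; apply/negP => h; apply: nw; apply/(orimx_aff _ dk).
  have [_ e] := mxrank_leqif_sup (addsmxSr w (orimx d k)).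
  apply: submx_trans (addsmxSl w (orimx d k)) _.
  by rewrite -e eqn_leq mxrankS ?addsmxSr //= (eqP frk).
have detN0 w T : ~ aff k w -> col_mx w (orimx d k) = T *m orimx (1 + d) l -> \det T != 0.
  move=> nw e; have := colv_free w nw; rewrite e /row_free => /eqP r.
  rewrite -unitfE -unitmxE -row_free_unit /row_free eqn_leq rank_leq_row /= -{1}r.
  exact: mxrankM_maxl.
have [T hT] := submxP (colv_sub v lv).
exists T => //; rewrite /incid; case: pdecP => [_|[]]; last by apply: codim1E => //; rewrite dk.
case: pdecP => [[w [lw [nw /(same_orientE w dk dl)[T' T'0 hT']]]]|h]; last first.
  rewrite mulrN1z mulN1r oppr_gt0 lt_neqAle (detN0 _ _ nkv hT) /= leNgt; apply/negP => T0.
  by apply: h; exists v; split=> //; split=> //; apply/(same_orientE v dk dl); exists T.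
rewrite mul1r; have [u [u0 hu]] := subcell_face fanF kl.
have upos x : cone l x -> ~ aff k x -> 0 < dotv u x.
  move=> lx nx; rewrite lt_neqAle u0 // andbT eq_sym; apply/eqP => e.
  by apply: nx; apply: cone_aff; apply/hu.
have : (v <= col_mx w (orimx d k))%MS.
  have [_ e] := mxrank_leqif_sup (colv_sub w lw).
  apply: submx_trans (_ : orimx (1 + d) l <= _)%MS; first exact/(orimx_aff _ dl)/cone_aff.
  by rewrite -e (eqP (colv_free w nw)) (eqP frl).
rewrite -addsmxE => /sub_addsmxP[[a y] /=]; rewrite (mx11_scalar a).
move: (a 0 0) => {}a ev.
(* The form [u] vanishes on [aff k] and is positive at both [v] and [w]. Hence [T] and [T'] differ
   by a block triangular factor of determinant [a > 0]. *)
have a0 : 0 < a.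
  have := upos v lv nkv; rewrite ev dotvDr mul_scalar_mx dotvZr.
  rewrite (_ : dotv u (y *m _) = 0) ?addr0; first by rewrite pmulr_lgt0 // upos.
  apply: (dotv_aff0 (k := k)); first by move=> x /hu[].
  by apply/(orimx_aff _ dk)/submxMl.
have eT : T = block_mx a%:M y 0 1%:M *m T'.
  apply: (row_free_inj frl); rewrite -mulmxA -hT' -hT mul_block_col mul0mx add0r mul1mx.
  by rewrite {1}ev.
by rewrite eT det_mulmx det_ublock det1 mulr1 det_scalar expr1 mulr_gt0.
Qed.

Lemma incid_pm1 (l k : idx) : codim1 l k -> incid o l k = 1 \/ incid o l k = -1.
Proof. by move=> h; rewrite /incid; case: pdecP => // _; case: ifP; [left|right]. Qed.

(** Two paths from [e] down to [g] append the same two vectors to a basis of [g] in opposite orders;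
    the transposition gives the sign. *)
Lemma incid_diamond (g d1 d2 e : idx) :
  set_sub (cone g) (cone d1) -> set_sub (cone g) (cone d2) ->
  set_sub (cone d1) (cone e) -> set_sub (cone d2) (cone e) ->
  cdim d1 = (cdim g).+1 -> cdim d2 = (cdim g).+1 -> cdim e = (cdim g).+2 -> d1 <> d2 ->
  incid o e d1 * incid o d1 g = - (incid o e d2 * incid o d2 g).
Proof.
move=> gd1 gd2 d1e d2e c1 c2 ce ne; set d := cdim g in c1 c2 ce.
have outside (d' : idx) : cdim d' = d.+1 -> exists2 v, cone d' v & ~ aff g v.
  move=> c; apply: NNPP => h; suff : (cdim d' <= cdim g)%N by rewrite c ltnn.
  apply: mxrankS; apply/row_subP => j; rewrite rowK; apply/affE; apply: NNPP => h'.
  by apply: h; exists (gens d')`_j => //; apply: cone_gen.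
(* Distinct cofaces of [g] meet only in [g], so a point of one outside [aff g] is not in the span of
   the other. *)
have sep (x y : idx) w : set_sub (cone g) (cone x) -> set_sub (cone g) (cone y) ->
    set_sub (cone x) (cone e) -> set_sub (cone y) (cone e) ->
    cdim x = d.+1 -> cdim y = d.+1 -> x <> y -> cone y w -> ~ aff g w -> ~ aff x w.
  move=> gx gy xe ye cx cy nxy yw ngw xw.
  have xw' : cone x w := subcell_aff fanF xe (ye _ yw) xw.
  have [m hm] := cell_cap fanF x y.
  have gm : set_sub (cone g) (cone m) by move=> z gz; apply/hm; split; [apply: gx|apply: gy].
  have mx : set_sub (cone m) (cone x) by move=> z /hm[].
  have my : set_sub (cone m) (cone y) by move=> z /hm[].
  have [le|lt] := leqP (cdim m) d.
    have eg : g = m by apply: (subcell_eq fanF gm).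
    by apply: ngw; apply: cone_aff; rewrite eg; apply/hm.
  apply: nxy; transitivity m; last by apply: (subcell_eq fanF my); rewrite cy.
  by apply/esym/(subcell_eq fanF mx); rewrite cx.
have [v1 dv1 nv1] := outside _ c1; have [v2 dv2 nv2] := outside _ c2.
have [T1 T10 h1] := incid_det gd1 (erefl d) c1 dv1 nv1.
have [T2 T20 h2] := incid_det gd2 (erefl d) c2 dv2 nv2.
have nd1 : ~ aff d1 v2 by apply: (@sep d1 d2).
have nd2 : ~ aff d2 v1 by apply: (@sep d2 d1) => //; apply: nesym.
have [T3 T30 h3] := @incid_det (1 + d) d1 e v2 d1e c1 ce (d2e _ dv2) nd1.
have [T4 T40 h4] := @incid_det (1 + d) d2 e v1 d2e c2 ce (d1e _ dv1) nd2.
have fre : row_free (orimx (1 + (1 + d)) e) by apply: orimx_free.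
have comp (T : 'M_(1 + d)) (T' : 'M_(1 + (1 + d))) (d' : idx) (u v : vec) :
    col_mx v (orimx d g) = T *m orimx (1 + d) d' ->
    col_mx u (orimx (1 + d) d') = T' *m orimx (1 + (1 + d)) e ->
    col_mx u (col_mx v (orimx d g)) = (block_mx 1%:M 0 0 T *m T') *m orimx (1 + (1 + d)) e.
  by move=> e1 e2; rewrite -mulmxA -e2 mul_block_col !mul0mx mul1mx addr0 add0r e1.
pose i0 : 'I_(1 + (1 + d)) := lshift _ ord0.
pose i1 : 'I_(1 + (1 + d)) := rshift 1 (lshift _ ord0).
have esw : col_mx v1 (col_mx v2 (orimx d g)) =
    tperm_mx i0 i1 *m col_mx v2 (col_mx v1 (orimx d g)).
  rewrite -row_permE; apply/matrixP => a b; rewrite [RHS]mxE.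
  case: (split_ordP a) => a' ->.
    by rewrite (ord1 a') tpermL col_mxEu col_mxEd col_mxEu.
  case: (split_ordP a') => a'' ->.
    by rewrite (ord1 a'') tpermR col_mxEd !col_mxEu.
  by rewrite tpermD ?col_mxEd //; apply/eqP => /(congr1 val).
have eM : block_mx 1%:M 0 0 T2 *m T4 = tperm_mx i0 i1 *m (block_mx 1%:M 0 0 T1 *m T3).
  apply: (row_free_inj fre); rewrite -(comp _ _ _ _ _ h2 h4) -[RHS]mulmxA.
  by rewrite -(comp _ _ _ _ _ h1 h3).
have eD : \det T2 * \det T4 = - (\det T1 * \det T3).
  have := congr1 determinant eM; rewrite !det_mulmx !det_ublock !det1 !mul1r => ->.
  by rewrite det_perm odd_tperm /= expr1 mulN1r.
have sq a b (x y : R) : 0 < a%:~R * x -> 0 < b%:~R * y -> 0 < (a * b)%:~R * (x * y).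
  by move=> ha hb; rewrite intrM mulrACA mulr_gt0.
have pm a b : a = 1 \/ a = -1 -> b = 1 \/ b = -1 -> a * b = 1 \/ a * b = -1 :> int.
  by move=> [->|->] [->|->]; [left|right|right|left].
have ce1 : cdim e = (cdim d1).+1 by rewrite ce c1.
have ce2 : cdim e = (cdim d2).+1 by rewrite ce c2.
have p1 := pm _ _ (incid_pm1 (codim1E d1e ce1)) (incid_pm1 (codim1E gd1 c1)).
have p2 := pm _ _ (incid_pm1 (codim1E d2e ce2)) (incid_pm1 (codim1E gd2 c2)).
have := sq _ _ _ _ T40 T20; have := sq _ _ _ _ T30 T10.
rewrite [_ * \det T2]mulrC eD [\det T3 * _]mulrC.
case: p1 => ->; case: p2 => ->; rewrite ?mulrN1z ?mulr1z ?mul1r ?mulN1r ?opprK //.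
  by rewrite oppr_gt0 => /lt_gtF ->.
by rewrite oppr_gt0 => /lt_gtF ->.
Qed.

End Orientation.

(** * Simplicial cones *)

Section SimplicialCone.
Variables (R : realType) (n : nat).
Local Notation vec := 'rV[R]_(n.+1).
Variable F : seq (seq vec).
Local Notation idx := 'I_(size F).
Hypotheses (fanF : is_fan F) (simpF : simplicial F).
Variables (s : idx).
Hypothesis ds : cdim s = n.+1.

(* Faces of a full-dimensional simplicial cone correspond to sets of its rays, the
   rows of [G]; [x *m H] is the vector of coordinates of [x] along the rays. *)
Lemma simplicial_chart : exists (m : nat) (G : 'M[R]_(m, n.+1)) (H : 'M[R]_(n.+1, m))
    (supp : idx -> {set 'I_m}),
  [/\ forall (k : idx) j, set_sub (cone k) (cone s) -> (j \in supp k) <-> cone k (row j G),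
      forall (k : idx) x, set_sub (cone k) (cone s) -> cone k x <->
        (forall j, 0 <= (x *m H) 0 j /\ (j \notin supp k -> (x *m H) 0 j = 0)),
      forall (k : idx) x, set_sub (cone k) (cone s) -> aff k x <->
        (forall j, j \notin supp k -> (x *m H) 0 j = 0),
      forall k : idx, set_sub (cone k) (cone s) -> cdim k = #|supp k| &
      forall B, exists k : idx, set_sub (cone k) (cone s) /\ supp k = B].
Proof.
have [g [/lin_indepE frg hg]] := simpF s.
have sg : (cellmx s <= seqmx g)%MS.
  by apply/row_subP => j; rewrite rowK; apply/pos_hull_span/hg/cone_gen.
have fullg : row_full (seqmx g).
  rewrite /row_full eqn_leq rank_leq_col /=; apply: leq_trans (mxrankS sg).
  by rewrite -cdimE ds.
set G := seqmx g in frg sg fullg; have [H GH] := row_freeP frg.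
have coK (x : vec) : (x *m H) *m G = x.
  by have /submxP[D ->] := submx_full x fullg; rewrite -[D *m G *m H]mulmxA GH mulmx1.
have coG j a : (row j G *m H) 0 a = (j == a)%:R.
  by rewrite -row_mul GH !mxE.
have cos x : cone s x <-> forall j, 0 <= (x *m H) 0 j.
  split=> [/hg[c [c0 ->]] j|h].
    by rewrite lincombE -mulmxA GH mulmx1 mxE.
  apply/hg; exists (coef_of (x *m H)); split; last by rewrite lincombE row_coef_of coK.
  by move=> j; rewrite /coef_of; case: insub.
have gs j : cone s (row j G) by apply/cos => a; rewrite coG ler0n.
pose supp (k : idx) : {set 'I_(size g)} := [set j | pdec (cone k (row j G))].
have suppP (k : idx) j : (j \in supp k) <-> cone k (row j G).
  by rewrite inE; split=> [/pdecP //|h]; apply/pdecP.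
have expand (u x : vec) : dotv u x = \sum_j (x *m H) 0 j * dotv u (row j G).
  rewrite -{1}(coK x) mulmx_sum_row; elim/big_ind2: _ => [|y a z b <- <-|j _].
  - by rewrite dotvE mul0mx mxE.
  - by rewrite dotvDr.
  - by rewrite dotvZr.
have dualE j (x : vec) : dotv (col j H)^T x = (x *m H) 0 j.
  by rewrite dotvE trmxK !mxE; apply: eq_bigr => a _; rewrite !mxE.
have coneP (k : idx) x : set_sub (cone k) (cone s) -> cone k x <->
    (forall j, 0 <= (x *m H) 0 j /\ (j \notin supp k -> (x *m H) 0 j = 0)).
  move=> ks; have [u [u0 hu]] := subcell_face fanF ks; split=> [/hu[sx ux] j|h].
    have pos := (cos x).1 sx; split=> // nj.
    have : \sum_j (x *m H) 0 j * dotv u (row j G) == 0 by rewrite -expand ux.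
    rewrite psumr_eq0 => [/allP /(_ j (mem_index_enum j))|a _]; last first.
      by rewrite mulr_ge0 ?u0.
    rewrite mulf_eq0 => /orP[/eqP //|/eqP uj].
    by case/negP: nj; apply/suppP/hu.
  apply/hu; split; first by apply/cos => j; case: (h j).
  rewrite expand big1 // => j _; have [jk|/(proj2 (h j)) ->] := boolP (j \in supp k).
    by move/suppP/hu: jk => [_ ->]; rewrite mulr0.
  by rewrite mul0r.
have affP (k : idx) x : set_sub (cone k) (cone s) -> aff k x <->
    (forall j, j \notin supp k -> (x *m H) 0 j = 0).
  move=> ks; split=> [kx j nj|h].
    rewrite -dualE; apply: dotv_aff0 kx => y /(coneP _ _ ks) /(_ j) [_ /(_ nj)].
    by rewrite dualE.
  apply/affE; rewrite -(coK x) mulmx_sum_row; apply: summx_sub => j _.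
  have [jk|/h ->] := boolP (j \in supp k); last by rewrite scale0r sub0mx.
  by apply: scalemx_sub; apply/affE/cone_aff/suppP.
exists (size g), G, H, supp; split=> // [k ks|B].
  (* The rays in [supp k] are independent and span [aff k], so the dimension counts them. *)
  pose f (j : 'I_#|supp k|) : 'I_(size g) := enum_val j.
  pose E : 'M[R]_(#|supp k|, size g) := rowsub f 1%:M.
  have EG : rowsub f G = E *m G by rewrite /E mul_rowsub_mx mul1mx.
  have frE : row_free (rowsub f G).
    apply/row_freeP; exists (H *m E^T); rewrite EG mulmxA -[E *m G *m H]mulmxA GH mulmx1.
    apply/matrixP => a b; rewrite mxE (bigD1 (f a)) //= !mxE eqxx mul1r big1 ?addr0.
      by rewrite (inj_eq enum_val_inj) eq_sym.
    by move=> c nc; rewrite !mxE eq_sym (negbTE nc) mul0r.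
  rewrite -(eqP frE); apply/eqP; rewrite eqn_leq; apply/andP; split; apply: mxrankS.
    apply/row_subP => j; set x := row j _.
    have kx : aff k x by rewrite /x rowK; apply/cone_aff/cone_gen.
    rewrite -(coK x) mulmx_sum_row; apply: summx_sub => a _.
    have [ak|/((affP k x ks).1 kx) ->] := boolP (a \in supp k); last by rewrite scale0r sub0mx.
    apply: scalemx_sub; have -> : row a G = row (enum_rank_in ak a) (rowsub f G).
      by apply/rowP => b; rewrite !mxE /f enum_rankK_in.
    exact: row_sub.
  apply/row_subP => j; have -> : row j (rowsub f G) = row (f j) G.
    by apply/rowP => b; rewrite !mxE.
  by apply/affE/cone_aff/suppP; apply: enum_valP.
(* The face with rays [B] is cut out by the sum of the coordinates outside [B], which is nonnegative
   on [s]. *)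
pose u : vec := \sum_(j in ~: B) (col j H)^T.
have uE (x : vec) : dotv u x = \sum_(j in ~: B) (x *m H) 0 j.
  rewrite /u; elim/big_ind2: _ => [|y a z b <- <-|j _].
  - by rewrite dotvE linear0 mulmx0 mxE.
  - by rewrite dotvDl.
  - by rewrite dualE.
have [k hk] : exists k : idx, forall x, cone k x <-> (cone s x /\ dotv u x = 0).
  apply: (face_cell fanF) => j; rewrite uE; apply: sumr_ge0 => a _.
  by apply: (cos _).1; apply: cone_gen.
exists k; split; first by move=> x /hk[].
apply/setP => j; apply/idP/idP => [/suppP/hk[_]|jB].
  rewrite uE => e; apply/negPn/negP => nj; move: e; rewrite (bigD1 j) ?inE //= coG eqxx.
  rewrite big1 ?addr0 => [/eqP|a /andP[_ na]]; first by rewrite oner_eq0.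
  by rewrite coG eq_sym (negbTE na).
apply/suppP/hk; split=> //; rewrite uE big1 // => a; rewrite inE coG => na.
by case: eqP na => // <-; rewrite jB.
Qed.

(** In the chart spans of faces are coordinate subspaces, which intersect as their index sets do. *)
Lemma simplicial_aff_cap (k k' m : idx) :
  set_sub (cone k) (cone s) -> set_sub (cone k') (cone s) ->
  (forall x, cone m x <-> (cone k x /\ cone k' x)) ->
  forall x, aff k x -> aff k' x -> aff m x.
Proof.
move=> ks k's hm; have ms : set_sub (cone m) (cone s) by move=> x /hm[/ks].
have [p [G [H [supp [hsupp _ haff _ _]]]]] := simplicial_chart.
move=> x /haff hx /haff hx'; apply/haff => // j nj.
have [jk|/hx -> //] := boolP (j \in supp k).
have [jk'|/hx' -> //] := boolP (j \in supp k').
by case/negP: nj; apply/hsupp => //; apply/hm; split; apply/hsupp.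
Qed.

(** [d1] and [d2] each add one ray to [g]. Adding both rays gives [e], which is an edge in the link
    of [g] with only these two endpoints. *)
Lemma simplicial_edge (g d1 d2 : idx) :
  set_sub (cone g) (cone d1) -> set_sub (cone g) (cone d2) ->
  set_sub (cone d1) (cone s) -> set_sub (cone d2) (cone s) ->
  cdim d1 = (cdim g).+1 -> cdim d2 = (cdim g).+1 -> d1 <> d2 ->
  exists e : idx, [/\ set_sub (cone d1) (cone e), set_sub (cone d2) (cone e),
    cdim e = (cdim g).+2 &
    forall d, set_sub (cone g) (cone d) -> set_sub (cone d) (cone e) ->
      cdim d = (cdim g).+1 -> d = d1 \/ d = d2].
Proof.
move=> gd1 gd2 d1s d2s c1 c2 ne.
have [p [G [H [supp [hsupp hcone _ hdim hex]]]]] := simplicial_chart.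
have gs : set_sub (cone g) (cone s) by move=> x /gd1 /d1s.
have sub (k l : idx) : set_sub (cone k) (cone s) -> set_sub (cone l) (cone s) ->
    set_sub (cone k) (cone l) <-> supp k \subset supp l.
  move=> ks ls; split=> [kl|/subsetP kl x /(hcone k x ks) kx].
    by apply/subsetP => j /hsupp jk; apply/hsupp => //; apply/kl/jk.
  apply/(hcone l x ls) => j; case: (kx j) => h1 h2; split=> // nj.
  by apply: h2; apply: contra nj; apply: kl.
have inj (k l : idx) : set_sub (cone k) (cone s) -> set_sub (cone l) (cone s) ->
    supp k = supp l -> k = l.
  by move=> ks ls e; apply: (cell_eq fanF); apply/sub => //; rewrite e.
have succ (d : idx) : set_sub (cone g) (cone d) -> set_sub (cone d) (cone s) ->
    cdim d = (cdim g).+1 -> exists2 a, a \notin supp g & supp d = a |: supp g.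
  move=> gd dS cd; have sgd := (sub _ _ gs dS).1 gd.
  have : #|supp d :\: supp g| = 1%N.
    by rewrite cardsD (setIidPr sgd) -!hdim // cd subSnn.
  move/eqP/cards1P => [a ea]; have : a \in supp d :\: supp g by rewrite ea set11.
  rewrite inE => /andP[na ad]; exists a => //.
  by rewrite -ea setUC -{1}(setIidPr sgd) setID.
have [a na ea] := succ _ gd1 d1s c1; have [b nb eb] := succ _ gd2 d2s c2.
have ab : a != b by apply/eqP => e; apply: ne; apply: inj => //; rewrite ea eb e.
have [e [es ee]] := hex (a |: (b |: supp g)).
exists e; split.
- by apply/sub => //; rewrite ee ea setUS // subsetUr.
- by apply/sub => //; rewrite ee eb subsetUr.
- by rewrite !hdim // ee !cardsU1 !inE negb_or ab na nb.
move=> d gd de cd; have dS : set_sub (cone d) (cone s) by move=> x /de /es.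
have [c nc ec] := succ _ gd dS cd.
have : c \in supp e by apply: (subsetP ((sub _ _ dS es).1 de)); rewrite ec setU11.
rewrite ee !inE (negbTE nc) orbF => /orP[/eqP e1|/eqP e1]; [left|right].
  by apply: inj => //; rewrite ec ea e1.
by apply: inj => //; rewrite ec eb e1.
Qed.

End SimplicialCone.

(** * Simplicial stars *)

Section SimplicialStar.
Variables (R : realType) (n : nat).
Local Notation vec := 'rV[R]_(n.+1).
Local Notation S := {mpoly R[n.+1]}.
Variable F : seq (seq vec).
Local Notation idx := 'I_(size F).
Variables (alpha : idx -> int) (o : idx -> seq vec).
Hypotheses (fanF : is_fan F) (pureF : pure F) (heredF : hereditary F).
Hypotheses (simpF : simplicial F) (oriF : orientation o).

(** * Constant homology of the star of a simplicial cell *)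

Section Star.
Variables (D : idx -> Prop) (g : idx).
Hypothesis DP : forall k, D k <-> set_sub (cone g) (cone k) /\ ~ Sm1 alpha k.
Hypothesis dg : (cdim g < n)%N.
Local Notation i := (cdim g).+1.
Local Notation B := (hbound o D (fun _ f => f = 0) i).
Local Notation vertex d := (set_sub (cone g) (cone d) /\ cdim d = i).

(** A chain on the single vertex [d] of the link of [g]; the incidence factor makes its boundary
    coefficient at [g] equal to [x], whatever the vertex. *)
Let e (d : idx) (x : S) (k : idx) : S := if k == d then (incid o d g)%:~R * x else 0.

Let BD c c' : B c -> B c' -> B (fun k => c k + c' k).
Proof. by apply: hbound_add => k a b -> ->; rewrite addr0. Qed.

Let B0 c : (forall k, D k -> c k = 0) -> B c.
Proof.
move=> c0; exists (fun=> 0); split=> // k Dk dk.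
by rewrite c0 // sub0r /dmap big1 ?oppr0 // => l _; rewrite mulr0.
Qed.

Let e_facet (s : idx) x (d1 d2 : idx) : facet s -> vertex d1 -> vertex d2 ->
  set_sub (cone d1) (cone s) -> set_sub (cone d2) (cone s) ->
  B (fun k => e d1 x k - e d2 x k).
Proof.
move=> fs [gd1 c1] [gd2 c2] d1s d2s.
have [->|/eqP ne] := eqVneq d1 d2; first by apply: B0 => k _; rewrite subrr.
have [t [d1t d2t ct ht]] := simplicial_edge fanF simpF (pureF fs) gd1 gd2 d1s d2s c1 c2 ne.
(* If the edge is in [Sm1 alpha], so are both endpoints, and the chain vanishes on [D]; otherwise a
   multiple of the edge bounds it. *)
case: (classic (Sm1 alpha t)) => [St|nSt].
  apply: B0 => k /DP [_ nk]; rewrite /e; case: eqP => [ek|_]; last case: eqP => [ek|_].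
  - by case: nk; rewrite ek; apply: Sm1_sub St.
  - by case: nk; rewrite ek; apply: Sm1_sub St.
  - by rewrite subrr.
have Dt : D t by apply/DP; split=> // y /gd1 /d1t.
have dia := incid_diamond fanF oriF gd1 gd2 d1t d2t c1 c2 ct ne.
have ct1 : cdim t = (cdim d1).+1 by rewrite ct c1.
have ct2 : cdim t = (cdim d2).+1 by rewrite ct c2.
pose y : S := (incid o t d1 * incid o d1 g)%:~R * x.
exists (fun l => if l == t then y else 0); split=> [l|k /DP[gk nk] dk].
  by case: eqP => // ->.
apply/eqP; rewrite subr_eq0; apply/eqP.
rewrite /dmap (bigD1 t) /=; last exact/pdecP.
rewrite eqxx big1 ?addr0; last by move=> l /andP[_ /negbTE ->]; rewrite mulr0.
rewrite /e; case: eqP => [->|nk1].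
  case: eqP => // _; rewrite subr0 /y mulrA -intrM mulrA incid_sq ?mul1r //.
  exact: codim1E.
case: eqP => [->|nk2].
  rewrite sub0r /y dia mulrA -intrM mulrN mulrA incid_sq ?mul1r; last exact: codim1E.
  by rewrite mulrNz mulNr.
rewrite subrr; have [->|/incid_sub [kt _]] := eqVneq (incid o t k) 0; first by rewrite mul0r.
by case: (ht k gk kt dk).
Qed.

(** Heredity links the facets around [g]. Consecutive ones share an [n]-face containing [g], and as
    [cdim g < n] this face contains a vertex through which to pass. *)
Let e_star x (d d' : idx) : vertex d -> vertex d' -> B (fun k => e d x k - e d' x k).
Proof.
move=> vd vd'; have [s [fs ds]] := facet_above fanF d; have [s' [fs' ds']] := facet_above fanF d'.
have gs : set_sub (cone g) (cone s) by case: vd => gd _ y /gd /ds.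
have gs' : set_sub (cone g) (cone s') by case: vd' => gd _ y /gd /ds'.
have [m [f [f0 [fm [hQ hE]]]]] := heredF fs gs fs' gs'.
suff H j : (j <= m)%N -> forall d' : idx, vertex d' -> set_sub (cone d') (cone (f j)) ->
    B (fun k => e d x k - e d' x k) by apply: (H m) => //; rewrite fm.
elim: j => [|j IH] hj d2 v2 d2s; first by apply: (@e_facet s) => //; rewrite -f0.
have [t [dt ht]] := hE j hj.
have [_ gj] := hQ j (ltnW hj); have [fj1 gj1] := hQ j.+1 hj.
have gt : set_sub (cone g) (cone t) by move=> y gy; apply/ht; split; [apply: gj|apply: gj1].
have [|d3 [gd3 d3t c3]] := subcell_succ fanF gt; first by rewrite dt.
have h1 := IH (ltnW hj) d3 (conj gd3 c3) (fun y hy => proj1 ((ht y).1 (d3t y hy))).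
have h2 := e_facet x fj1 (conj gd3 c3) v2 (fun y hy => proj2 ((ht y).1 (d3t y hy))) d2s.
by apply: hbound_ext (BD h1 h2) => k _; rewrite addrA subrK.
Qed.

(** Every coefficient of a cycle is moved to one vertex [d0], where their sum is the boundary at
    [g]. *)
Lemma star_H_zero : H_zero o D (fun _ f => f = 0) i.
Proof.
move=> z [hz cyc].
(* The cycle condition at [g] is available only if [g] is outside [Sm1 alpha]. Otherwise [d0] is
   chosen inside, where chains vanish on [D]. *)
have [d0 [v0 hd0]] : exists d0 : idx, vertex d0 /\ (Sm1 alpha g -> Sm1 alpha d0).
  case: (classic (Sm1 alpha g)) => [[t [dt [at1 gt]]]|ng].
    have [|d [gd dt' cd]] := subcell_succ fanF gt; first by rewrite dt.
    by exists d; split=> // _; exists t.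
  have [s [fs gs]] := facet_above fanF g.
  have [|d [gd _ cd]] := subcell_succ fanF gs; first by rewrite (pureF fs) ltnS ltnW.
  by exists d.
pose x (l : idx) : S := (incid o l g)%:~R * z l.
have H1 : B (fun k => \sum_l (e l (x l) k - e d0 (x l) k)).
  suff H r : B (fun k => \sum_(l <- r) (e l (x l) k - e d0 (x l) k)) by apply: H.
  elim: r => [|l r IH]; first by apply: B0 => k _; rewrite big_nil.
  have Bl : B (fun k => e l (x l) k - e d0 (x l) k).
    have [e0|nz] := eqVneq (incid o l g) 0.
      by apply: B0 => k _; rewrite /e /x e0 !mul0r !mulr0 !if_same subrr.
    have [gl [c1 c2]] := incid_sub nz; apply: e_star => //; split=> //.
    by rewrite c1 prednK.
  by apply: hbound_ext (BD Bl IH) => k _; rewrite big_cons.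
have H2 : B (e d0 (\sum_l x l)).
  apply: B0 => k /DP[gk nk]; rewrite /e; case: eqP => // ek.
  have ng : ~ Sm1 alpha g by move=> /hd0; rewrite -ek.
  have := cyc g; rewrite DP => /(_ (conj (fun _ h => h) ng) (erefl _)).
  rewrite /dmap => h; rewrite (bigID (fun l => pdec (D l))) /= h [X in 0 + X]big1 ?addr0 ?mulr0 //.
  move=> l /pdecP nD; rewrite /x; have [->|/eqP/hz[] //] := eqVneq (z l) 0.
  by rewrite mulr0.
apply: hbound_ext (BD H1 H2) => k /DP[gk nk].
rewrite sumrB; have -> : \sum_l e d0 (x l) k = e d0 (\sum_l x l) k.
  by rewrite /e; case: eqP => _; [rewrite mulr_sumr | rewrite big1].
rewrite subrK (bigD1 k) //= big1 ?addr0 /e ?eqxx => [|l /negbTE nl]; last first.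
  by rewrite eq_sym nl.
rewrite /x mulrA -intrM; have [->|/eqP/hz[Dk dk]] := eqVneq (z k) 0; first by rewrite mulr0.
by rewrite incid_sq ?mul1r //; apply: codim1E.
Qed.

End Star.

(* In a simplicial cone the faces spanning [W] have a least element, and walls
   containing [W] contain it, so it is the same for the whole class of [s]. *)
Lemma least_cell (W : vec -> Prop) (s : idx) : facet s ->
  exists g : idx, [/\ set_sub (cone g) (cone s), set_sub W (aff g) &
    forall k, SigmaW W s k -> set_sub W (aff k) -> set_sub (cone g) (cone k)].
Proof.
move=> fs; have s0 : pdec (set_sub (cone s) (cone s) /\ set_sub W (aff s)).
  apply/pdecP; split=> // x _; apply/affE/submx_full.
  by rewrite /row_full -cdimE pureF.
case: (arg_minnP (P := fun k => pdec (set_sub (cone k) (cone s) /\ set_sub W (aff k)))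
         (fun k : idx => cdim k) s0) => g /pdecP[gs Wg] gmin.
exists g; split=> //.
have key (s' k : idx) : facet s' -> set_sub (cone g) (cone s') -> set_sub (cone k) (cone s') ->
    set_sub W (aff k) -> set_sub (cone g) (cone k).
  move=> fs' gs' ks' Wk; have [m hm] := cell_cap fanF k g.
  have mg : set_sub (cone m) (cone g) by move=> x /hm[].
  have Wm : set_sub W (aff m).
    move=> x Wx; apply: (simplicial_aff_cap fanF simpF (pureF fs') ks' gs' hm).
      exact: Wk.
    exact: Wg.
  have em : m = g.
    apply: (subcell_eq fanF mg); apply: gmin; apply/pdecP; split=> //.
    by move=> x /mg /gs.
  by move=> x gx; have /hm[] : cone m x by rewrite em.
move=> k [s' [[m [f [f0 [fm [hQ hE]]]]] ks']] Wk.
apply: (key s') => //; first by rewrite -fm; apply: hQ.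
suff H j : (j <= m)%N -> set_sub (cone g) (cone (f j)) by rewrite -fm; apply: H.
elim: j => [|j IH] hj; first by rewrite f0.
have [t [dt [ht Wt]]] := hE j hj.
have gt : set_sub (cone g) (cone t).
  apply: (key (f j)) => //; [exact/hQ/ltnW | exact/IH/ltnW | by move=> x /ht[]].
by move=> x /gt /ht[].
Qed.

End SimplicialStar.

(** * The three inclusions for associated primes *)

Theorem theorem5p5 (R : realType) (n : nat) (F : seq (seq 'rV[R]_(n.+1)))
    (alpha : 'I_(size F) -> int) (o : 'I_(size F) -> seq 'rV[R]_(n.+1)) :
  is_fan F -> pure F -> hereditary F -> smoothness alpha -> orientation o ->
  forall i : nat, (1 <= i <= n)%N ->
    (* (1) *)
    (forall P, ass_RJ alpha o i P ->
       exists (W : 'rV[R]_(n.+1) -> Prop) (d : nat),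
         inL alpha W /\ dimW W d /\ (d + 1 <= i)%N /\ (forall f, P f <-> idealW W f))
    /\
    (* (2) *)
    ((forall (W : 'rV[R]_(n.+1) -> Prop) (s : 'I_(size F)),
        inL alpha W -> dimW W (i - 1) -> facet s -> cdim s = n.+1 ->
        H_R_WS_zero alpha o W s i) ->
     forall P, ass_RJ alpha o i P ->
       exists (W : 'rV[R]_(n.+1) -> Prop) (d : nat),
         inL alpha W /\ dimW W d /\ (d + 2 <= i)%N /\ (forall f, P f <-> idealW W f))
    /\
    (* (3) *)
    (simplicial F ->
     forall P, ass_RJ alpha o i P ->
       exists g : 'I_(size F),
         inL alpha (aff g) /\ (cdim g + 2 <= i)%N /\
         (forall f, P f <-> idealW (aff g) f)).
Proof.
move=> fanF pureF heredF _ oriF i /andP[i1 lin].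
have main P : ass_RJ alpha o i P -> let W := Pflat alpha P in
  exists (s : 'I_(size F)) c (A : 'M[R]_n.+1), let D := Dclass alpha W s in
    [/\ facet s, forall x, W x <-> (x <= A)%MS, (\rank A < i)%N,
       forall f, P f <-> idealW W f &
       [/\ forall f, P f <-> hbound o D (Jid alpha (fun _ => True) (Sm1 alpha)) i
                              (fun k => f * c k),
          ~ P 1 & (i = (\rank A).+1 -> ~ H_R_WS_zero alpha o W s i)]].
  move=> [primeP [c0 [cyc0 hP0]]] W.
  have [s [c [fs cyc hP]]] := ann_component fanF pureF heredF primeP cyc0 hP0.
  have [A hA] := Pflat_mx alpha P.
  have nP1 : ~ P 1 by case: primeP => _ [_ [_ []]].
  have nB : ~ hbound o (Dclass alpha W s) (Jid alpha (fun _ => True) (Sm1 alpha)) i c.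
    by move=> h; apply: nP1; apply/hP; apply: hbound_ext h => k _; rewrite mul1r.
  have DA k : Dclass alpha W s k -> (A <= cellmx k)%MS.
    move=> /DclassE[_ Wk _]; apply/row_subP => j; apply/affE/Wk/hA; exact: row_sub.
  have Dup := @Dclass_up _ _ _ alpha fanF heredF W s.
  have IA f : idealW W f <-> idealW (rowsp A) f.
    by split=> h x hx; apply: h; apply/hA.
  exists s, c, A; split=> //.
  - rewrite ltnNge; apply/negP => ri; apply: nB.
    by apply: (hbound_high alpha o fanF pureF Dup DA lin ri); case: cyc.
  - move=> f; split; last exact: idealW_Pflat.
    move=> Pf; apply/IA; have IP h : idealW (rowsp A) h -> P h.
      by move/IA; apply: idealW_Pflat.
    apply: (ann_idealW (alpha := alpha) _ nP1 hP IP Pf).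
    by move=> k x /DA Ak xA; apply/affE/(submx_trans xA).
  - split=> // ei H0; apply: nB.
    exact: (hbound_corner fanF Dup DA lin ei cyc H0).
split; last split.
- move=> P /main[s [c [A [fs hA ri hP _]]]]; exists (Pflat alpha P), (\rank A).
  by split; [apply: inL_Pflat | split; [apply/(dimW_rank _ hA) | rewrite addn1]].
- move=> H0 P /main[s [c [A [fs hA ri hP [_ _ nH]]]]]; exists (Pflat alpha P), (\rank A).
  split; [exact: inL_Pflat | split; [exact/(dimW_rank _ hA) | split=> //]].
  rewrite addn2 ltn_neqAle ri andbT; apply/eqP => ei; apply: (nH (esym ei)).
  apply: H0 => //; [exact: inL_Pflat | | exact: pureF].
  by apply/(dimW_rank _ hA); rewrite -ei subn1.
- move=> simpF P /main[s [c [A [fs hA ri hP [hB nP1 nH]]]]].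
  have [g [gs Wg gmin]] := least_cell fanF pureF simpF (Pflat alpha P) fs.
  have Dg k : Dclass alpha (Pflat alpha P) s k -> set_sub (cone g) (cone k).
    by move=> /DclassE[h1 h2 _]; apply: gmin.
  (* All cells of the class contain [g], so translation invariance holds along [aff g] and not only
     along the flat. *)
  have Pg f : P f -> idealW (aff g) f.
    move=> Pf; suff h : idealW (rowsp (cellmx g)) f by move=> x /affE; apply: h.
    have IP h : idealW (rowsp (cellmx g)) h -> P h.
      by move=> hg; apply/hP => x /Wg /affE; apply: hg.
    apply: (ann_idealW (alpha := alpha) _ nP1 hB IP Pf).
    by move=> k x /Dg gk /affE; apply: aff_sub.
  (* A form vanishing on the flat but not at [x] would lie in [P], hence in the ideal of [aff g]. *)
  have eW x : aff g x <-> Pflat alpha P x.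
    split=> [gx|/Wg //]; apply: NNPP => nx.
    have [v [v1 /eqP []]] : exists v, (forall y, (y <= A)%MS -> dotv v y = 0) /\ dotv v x != 0.
      by apply: separating_form; apply/negP => /hA.
    rewrite -ev_linform; apply: (Pg (linform v)) => //; apply/hP => y /hA /v1.
    by rewrite -/(ev y _) ev_linform.
  have rg : cdim g = \rank A.
    by apply/(dimW_rank _ hA)/(dimW_rank (A := cellmx g)) => // x; rewrite -eW affE.
  exists g; split; last split.
  + have [T [hT1 hT2]] := inL_Pflat alpha P; exists T; split=> // x.
    by rewrite eW; apply: hT2.
  + rewrite addn2 rg ltn_neqAle ri andbT; apply/eqP => ei; apply: (nH (esym ei)).
    (* The class of [s] is the star of [g] without [Sm1 alpha], and [cdim g = i - 1] is less than
       [n]. *)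
    rewrite /H_R_WS_zero -ei -rg; apply: (star_H_zero (alpha := alpha)) => //; last first.
      by rewrite rg ei.
    move=> k; split=> [Dk|[gk nk]]; first by split; [apply: Dg | case/DclassE: Dk].
    apply/DclassE; split=> //; last by move=> x /Wg; apply: aff_sub.
    by apply: (SigmaW_up fanF heredF Wg gk); apply: SigmaW_facet.
  + by move=> f; rewrite hP; split=> h x /eW; apply: h.
Qed.
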